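(* Let $\mathcal{H}$ be a real Hilbert space and let $f:\mathcal{H}\to\mathbb{R}\cup\{+\infty\}$ be proper, convex, lower semicontinuous with $\operatorname{argmin} f\neq\emptyset$. Let $\alpha,c>0$, $0<q<1$, $1<p\le q+1$, $\lambda>0$, $\delta\le 0$, and if $\delta=0$ assume $\lambda\in\,]0,1[$. For $k\ge1$ put $\alpha_k=1-\frac{\alpha}{k^q}$, $c_k=\frac{c}{k^p}$, $\lambda_k=\lambda k^\delta$. Let $x_0,x_1\in\mathcal H$ and let $(x_k)$ be generated by $$x_{k+1}=\operatorname{prox}_{\lambda_k f}\big(x_k+\alpha_k(x_k-x_{k-1})-c_kx_k\big),\quad k\ge1.$$ For every $k\ge 2$ let $u_k\in\partial f(x_k)$ be the element satisfying $$x_k=\alpha_{k-1}(x_{k-1}-x_{k-2})-\lambda_{k-1}u_k+(1-c_{k-1})x_{k-1}.$$ For $k\ge1$ let $f_k(x)=f(x)+\frac{c}{2k^p}\|x\|^2$ and let $\overline{x}_k$ be the unique minimizer of $f_k$ over $\mathcal H$. Then the following hold. (i) If $p<q+1$, then $(x_k)$ is bounded and $$f(x_k)-\min_{\mathcal H} f=\mathcal{O}(k^{-p-\delta}),\quad \|x_k-x_{k-1}\|=\mathcal{O}(k^{-\frac p2}),\quad \|u_k\|=\mathcal{O}(k^{-\frac p2-\delta})\quad\text{as }k\to+\infty.$$ Further, for all $s\in\left]\frac12,\frac p2\right[$ one has $$\sum_{k=2}^{+\infty}k^{2s+\delta-1}(f(x_k)-\min_{\mathcal H} f)<+\infty,\quad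 \sum_{k=1}^{+\infty}k^{2s-q}\|x_k-x_{k-1}\|^2<+\infty,\quad \sum_{k=2}^{+\infty}k^{2s+2\delta}\|u_k\|^2<+\infty.$$ Moreover, $$\limsup_{n\to+\infty}\frac{\sum_{k=3}^n k^{q+\delta}(f_{k-1}(x_{k-1})-f_{k-1}(\overline{x}_{k-1}))}{n^{q+1-p}}<+\infty,\quad \limsup_{n\to+\infty}\frac{\sum_{k=1}^n k\|x_k-x_{k-1}\|^2}{n^{q+1-p}}<+\infty,$$ $$\limsup_{n\to+\infty}\frac{\sum_{k=2}^n k^{q+1+2\delta}\|u_k\|^2}{n^{q+1-p}}<+\infty.$$ (ii) If $p=q+1$, then $$f(x_k)-\min_{\mathcal H} f=\mathcal{O}(k^{-p-\delta}\ln k),\quad \|x_k-x_{k-1}\|=\mathcal{O}(k^{-\frac p2}\sqrt{\ln k}),\quad \|u_k\|=\mathcal{O}(k^{-\frac p2-\delta}\sqrt{\ln k})\quad\text{as }k\to+\infty.$$ Further, for all $s\in\left]\frac12,\frac p2\right[$ one has $$\sum_{k=2}^{+\infty}k^{2s+\delta-1}(f(x_k)-\min_{\mathcal H} f)<+\infty,\quad \sum_{k=1}^{+\infty}k^{2s-q}\|x_k-x_{k-1}\|^2<+\infty,\quad \sum_{k=2}^{+\infty}k^{2s+2\delta}\|u_k\|^2<+\infty.$$ Moreover, $$\limsup_{n\to+\infty}\frac{\sum_{k=3}^n k^{q+\delta}(f_{k-1}(x_{k-1})-f_{k-1}(\overline{x}_{k-1}))}{\ln n}<+\infty,\quad \limsup_{n\to+\infty}\frac{\sum_{k=1}^n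 k\|x_k-x_{k-1}\|^2}{\ln n}<+\infty,$$ $$\limsup_{n\to+\infty}\frac{\sum_{k=2}^n k^{q+1+2\delta}\|u_k\|^2}{\ln n}<+\infty.$$ Additionally, if $\delta<0$, then $$\limsup_{n\to+\infty}\frac{\sum_{k=3}^n k^{q+\delta}(f(x_{k-1})-\min_{\mathcal H} f)}{\ln n}<+\infty.$$
   Context: For $s>0$, $\operatorname{prox}_{sf}(x)=\operatorname{argmin}_{y\in\mathcal H}\left(f(y)+\frac{1}{2s}\|y-x\|^2\right)$. $\partial f$ is the convex subdifferential; since $\operatorname{prox}_{sf}=(I+s\,\partial f)^{-1}$, the vector $u_k$ defined by the stated equality indeed belongs to $\partial f(x_k)$. *)

(* Defs.v *)
From HB Require Import structures.
From mathcomp Require Import all_boot all_order all_algebra.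
From mathcomp Require Import all_classical all_reals all_analysis.

Set Implicit Arguments.
Unset Strict Implicit.
Unset Printing Implicit Defensive.

Import Order.TTheory GRing.Theory Num.Theory.
Import numFieldNormedType.Exports.

Local Open Scope classical_set_scope.
Local Open Scope ring_scope.
Local Open Scope ereal_scope.

(* A real Hilbert space is a complete normed space whose norm comes from an
   inner product. *)
Definition norm_from_dot (R : realType) (H : completeNormedModType R)
    (dot : {dot H for @idfun R}) : Prop :=
  forall x : H, dot x x = (`|x| ^+ 2)%R.

(* Extended-valued functions have codomain \bar R; properness excludes -oo. *)
Definition proper_fun (R : realType) (T : Type) (f : T -> \bar R) : Prop :=
  (forall x, f x != -oo) /\ (exists x, f x != +oo).

Definition econvex_fun (R : realType) (H : lmodType R)
    (f : H -> \bar R) : Prop :=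
  forall (x y : H) (t : R), (0 < t < 1)%R ->
    f (t *: x + (1 - t) *: y)%R <= t%:E * f x + (1 - t)%:E * f y.

Definition argmin (R : realType) (T : Type) (f : T -> \bar R) : set T :=
  [set x | forall y, f x <= f y].

Definition min_val (R : realType) (T : Type) (f : T -> \bar R) : \bar R :=
  ereal_inf (range f).

(* [get A] is an element of A when A is nonempty (an arbitrary point of the
   space otherwise).  Below it is applied only to functions with exactly one
   minimizer: proper lsc strongly convex ones. *)
Definition the_argmin (R : realType) (T : pointedType)
    (f : T -> \bar R) : T := get (argmin f).

Definition prox (R : realType) (H : completeNormedModType R) (s : R)
    (f : H -> \bar R) (x : H) : H :=
  the_argmin (fun y : H => f y + ((2 * s)^-1 * `|y - x| ^+ 2)%:E).

Definition subdifferential (R : realType) (H : completeNormedModType R)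
    (dot : {dot H for @idfun R}) (f : H -> \bar R) (x : H) : set H :=
  [set u | forall y : H, f x + (dot u (y - x)%R)%:E <= f y].

Definition inertia_coef (R : realType) (alpha q : R) (k : nat) : R :=
  (1 - alpha / k%:R `^ q)%R.

Definition tikhonov_coef (R : realType) (c p : R) (k : nat) : R :=
  (c / k%:R `^ p)%R.

Definition step_size (R : realType) (lambda delta : R) (k : nat) : R :=
  (lambda * k%:R `^ delta)%R.

Definition tikhonov (R : realType) (H : completeNormedModType R)
    (f : H -> \bar R) (c p : R) (k : nat) (x : H) : \bar R :=
  f x + (c / (2 * k%:R `^ p) * `|x| ^+ 2)%:E.

(* Main.v *)
(* Fix a minimizer z of f and put d_k = x_k - x_{k-1}, y_k = x_k - z,
   F_k = f(x_k) - min f, lambda_k = lambda k^delta, c_k = c / k^p.  The energy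
     W_k = |d_k|^2 / 2 + lambda_k F_k + c_k |x_k|^2 / 2
   is dissipated at rate k^-q |d_k|^2, while
     B_k = k^q <d_k, y_k> + alpha |y_{k-1}|^2 / 2
   decreases at rate k^q (lambda_k F_k + c_k |x_k|^2 / 2) up to O(k^q |d_k|^2) and
   up to the forcing term c k^(q-p) |z|^2 / 2 due to the Tikhonov regularization.
   Hence V_k = k^(q+1) W_k + 16 B_k, which dominates k^(q+1) W_k / 2, satisfies
     V_{k+1} + eta T_{k+1} <= V_k + C k^(q-p)
   for large k, where T_k = k^(q+1+2delta) |u_k|^2 + k |d_k|^2 + k^(q+delta) F_k
   + k^(q-p) |x_k|^2.  Summation bounds V_n, T_n and the partial sums of T by the
   partial sums of k^(q-p), which are O(n^(q+1-p)) or O(ln n).  Multiplying by the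
   decreasing weight k^(2s-q-1) before summing makes the forcing term summable.
   The anchor z serves for the Tikhonov values as well, because every y satisfies
   f_k(y) >= min f, so that f_k(x_k) - f_k(xbar_k) <= F_k + c_k |x_k|^2 / 2. *)
Require Import Defs.
From mathcomp Require Import all_boot all_order all_algebra.
From mathcomp Require Import all_classical all_reals all_analysis.
From mathcomp Require Import ring lra.

Set Implicit Arguments.
Unset Strict Implicit.
Unset Printing Implicit Defensive.

Import Order.TTheory GRing.Theory Num.Theory.
Import numFieldNormedType.Exports.

Local Open Scope classical_set_scope.
Local Open Scope ring_scope.

(** * The one-step Lyapunov inequality as an inequality between real numbers *)

(* In [lyapunov_step], [k], [Q], [Q'], [P] are the values of k, k^q, (k+1)^q, k^p,
   and [A], [A'], [X], [X'], [Y], [Z], [E], [U] are the squared norms of [d], [d'],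
   [y + z], [y + z + d'], [y], [z], [d' - d], [u]. *)
Lemma lyapunov_scalar (R : realType)
    (k Q Q' P al c l l' c' F F' eta A A' X X' Y Z E U W B B' s1 s2 s3 sy : R) :
  0 <= A -> 0 <= A' -> 0 <= X -> 0 <= X' -> 0 <= Y -> 0 <= E ->
  0 <= F' ->
  1 <= k -> 1 <= Q -> Q <= Q' -> Q' <= Q + Q / k -> k <= P -> P <= k ^+ 2 ->
  0 < al -> 0 < c -> 0 <= l -> l' <= l -> c' <= c / P ->
  2 * al <= Q -> (26 + 20 * c + 32 / c) * Q <= al / 4 * k ->
  0 < eta -> eta <= 12^-1 -> eta <= 12^-1 * al -> 12 * al * eta <= 1 ->
  (3 * c ^+ 2 + 2) * eta <= c ->
  2^-1 * A' + l * F' + c / P / 2 * X' <= W - (1 - al / Q) / 2 * E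
    - al / Q / 2 * (A + A') + c / P / 2 * A' ->
  B' <= B + (Q' - Q) * s1 + (Q - al) * s2 - al / 2 * A - Q * l * F'
    - Q * (c / P) * s3 ->
  s1 = sy + A' -> 2 * sy <= c * k / (4 * P) * Y + (c * k / (4 * P))^-1 * A' ->
  2 * s2 <= A + A' -> 4^-1 * X + 2^-1 * Y - 2^-1 * Z - A' <= s3 ->
  X' <= 2 * X + 2 * A' ->
  l ^+ 2 * U <= 3 * E + 3 * (al / Q) ^+ 2 * A + 3 * (c / P) ^+ 2 * X ->
  (k + 1) * Q' * (2^-1 * A' + l' * F' + c' / 2 * X') + 16 * B'
  + eta * (k * Q * l ^+ 2 * U + k * A' + Q * l * F' + Q / P * X')
  <= k * Q * W + 16 * B + 8 * c * (Q / P) * Z.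
Proof.
move=> A0 A'0 X0 X'0 Y0 E0 F'0 k1 Q1 QQ' Q'k kP Pk al0 c0 l0 l'l c'c alQ Ck.
move=> e0 e1 e2 e3 e4 hW hB s1E hsy hs2 hs3 hX hU.
have k0 : 0 < k := lt_le_trans ltr01 k1.
have Q0 : 0 < Q := lt_le_trans ltr01 Q1.
have P0 : 0 < P := lt_le_trans k0 kP.
have k0' := ltW k0; have Q0' := ltW Q0; have c0' := ltW c0.
have half0 : 0 <= 2^-1 :> R by rewrite invr_ge0 ler0n.
have kn : k != 0 by rewrite gt_eqF.
have Pn : P != 0 by rewrite gt_eqF.
have Qn : Q != 0 by rewrite gt_eqF.
have cn : c != 0 by rewrite gt_eqF.
set g := Q / P in hB *.
have g0 : 0 <= g by rewrite divr_ge0// ltW.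
have gk : k * g <= Q.
  by rewrite /g mulrA ler_pdivrMr// mulrC ler_pM2l.
have gQ : g <= Q by apply: le_trans gk; rewrite ler_peMl.
have Qk0 : Q / k <= Q by rewrite ler_pdivrMr// ler_peMr// ltW.
set W1 := 2^-1 * A' + l * F' + c / P / 2 * X' in hW.
have cP0 : 0 <= c / P by rewrite divr_ge0// ltW.
have lF0 : 0 <= l * F' by rewrite mulr_ge0.
have W10 : 0 <= W1.
  by rewrite /W1 !addr_ge0// mulr_ge0// divr_ge0.
(* The weight grows by at most [3 * Q], because [(k + 1) * (Q + Q / k) = k * Q + 2 * Q + Q / k]. *)
have S1 : (k + 1) * Q' * (2^-1 * A' + l' * F' + c' / 2 * X')
    <= (k * Q + 3 * Q) * W1.
  apply: (@le_trans _ _ ((k + 1) * Q' * W1)).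
    apply: ler_wpM2l; first by rewrite mulr_ge0 ?addr_ge0 ?(le_trans Q0' QQ').
    rewrite /W1; apply: lerD; last by do 2![apply: ler_wpM2r => //].
    by apply: lerD => //; apply: ler_wpM2r.
  apply: ler_wpM2r => //.
  apply: (@le_trans _ _ ((k + 1) * (Q + Q / k))).
    by apply: ler_wpM2l => //; rewrite addr_ge0.
  rewrite [leLHS](_ : _ = k * Q + 2 * Q + Q / k); last by field.
  by move: Qk0; clear; lra.
have S2 : k * Q * W1 <= k * Q * W - k * (Q - al) / 2 * E
    - al / 2 * k * (A + A') + c / 2 * (Q * A').
  have kQ0 : 0 <= k * Q by rewrite mulr_ge0 ?(ltW al0).
  have /le_trans := ler_wpM2l kQ0 hW; apply.
  rewrite [leLHS](_ : _ = k * Q * W - k * (Q - al) / 2 * E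
    - al / 2 * k * (A + A') + c / 2 * ((k * g) * A')); last first.
    by rewrite /g; field; rewrite Pn Qn.
  by rewrite lerD2l ler_wpM2l ?ler_wpM2r// divr_ge0// ltW.
have gA' : g * A' <= Q * A' by rewrite ler_wpM2r.
have gX' : g * X' <= 2 * (g * X) + 2 * (Q * A').
  by have := ler_wpM2l g0 hX; move: gA'; clear; lra.
have S3 : 3 * Q * W1 <= (3 / 2 + 3 * c) * (Q * A') + 3 * (Q * (l * F'))
    + 3 * c * (g * X).
  rewrite [leLHS](_ : _ = 3 / 2 * (Q * A') + 3 * (Q * (l * F'))
    + 3 / 2 * c * (g * X')); last by rewrite /W1 /g; field.
  by have := ler_wpM2l (ltW c0) gX'; clear; lra.
(* The Young weight [c * k / (4 * P)] turns the [Y] part, multiplied by [Q / k], into exactly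
   [c / 8 * (g * Y)]; the [A'] part is then bounded through [P <= k ^+ 2]. *)
have S4 : (Q' - Q) * sy <= c / 8 * (g * Y) + 2 / c * (Q * A').
  set t := c * k / (4 * P) in hsy.
  have t0 : 0 < t by rewrite divr_gt0// mulr_gt0.
  set m := t * Y + t^-1 * A' in hsy.
  have m0 : 0 <= m by rewrite addr_ge0// mulr_ge0// ?invr_ge0 ltW.
  apply: (@le_trans _ _ ((Q' - Q) * (m / 2))).
    by apply: ler_wpM2l; [rewrite subr_ge0|move: hsy; clear; lra].
  apply: (@le_trans _ _ (Q / k * (m / 2))).
    by apply: ler_wpM2r; [rewrite divr_ge0|rewrite lerBlDl].
  rewrite [leLHS](_ : _ = c / 8 * (g * Y) + 2 / c * (Q * A' * (P / k ^+ 2)));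
    last by rewrite /m /t /g; field; rewrite kn Pn cn.
  rewrite lerD2l; apply: ler_wpM2l; first by rewrite divr_ge0// ltW.
  apply: ler_piMr; first by rewrite mulr_ge0// ltW.
  by rewrite ler_pdivrMr ?mul1r// exprn_gt0.
have S5 : (Q' - Q) * A' <= Q * A' by apply: ler_wpM2r => //; move: Q'k Qk0; clear; lra.
have S6 : (Q - al) * s2 <= 2^-1 * (Q * A) + 2^-1 * (Q * A').
  apply: (@le_trans _ _ ((Q - al) * ((A + A') / 2))).
    by apply: ler_wpM2l; [move: alQ al0; clear|move: hs2; clear]; lra.
  apply: (@le_trans _ _ (Q * ((A + A') / 2))); last by clear; lra.
  by apply: ler_wpM2r; [move: A0 A'0|move: al0]; clear; lra.
have S7 : - (Q * (c / P) * s3) <= - (c / 4 * (g * X)) - c / 2 * (g * Y)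
    + c / 2 * (g * Z) + c * (Q * A').
  have gc0 : 0 <= c * g by rewrite mulr_ge0// ltW.
  have := ler_wpM2l gc0 hs3.
  rewrite (_ : Q * (c / P) = c * g); last by rewrite /g; field.
  by have := ler_wpM2l (ltW c0) gA'; clear; lra.
have S8 : k * Q * l ^+ 2 * U <= 3 * (k * Q * E) + 3 * al * (al * k * A)
    + 3 * c ^+ 2 * (g * X).
  have kQ0 : 0 <= k * Q by rewrite mulr_ge0 ?(ltW al0).
  rewrite -mulrA; have /le_trans := ler_wpM2l kQ0 hU; apply.
  rewrite [leLHS](_ : _ = 3 * (k * Q * E) + 3 * al * (al * k * A * Q^-1)
    + 3 * c ^+ 2 * (g * X * (k / P))); last by rewrite /g; field; rewrite Pn Qn.
  apply: lerD; first apply: lerD => //; apply: ler_wpM2l.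
  - by rewrite mulr_ge0 ?ler0n// ltW.
  - by apply: ler_piMr; [rewrite !mulr_ge0// ltW|rewrite invf_le1].
  - by rewrite mulr_ge0 ?ler0n// sqr_ge0.
  - by apply: ler_piMr; [apply: mulr_ge0|rewrite ler_pdivrMr ?mul1r].
have T1 : 0 <= k * Q * E by rewrite !mulr_ge0// ltW.
have T2 : 0 <= al * k * A by rewrite !mulr_ge0// ltW.
have T3 : 0 <= g * X by rewrite mulr_ge0.
have T4 : 0 <= k * A' by rewrite mulr_ge0// ltW.
have T7 : 0 <= al * (k * A') by rewrite mulr_ge0// ltW.
have T5 : 0 <= Q * (l * F') by rewrite mulr_ge0// ltW.
have T6 : k * Q / 4 * E <= k * (Q - al) / 2 * E.
  by apply: ler_wpM2r => //; rewrite -!mulrA ler_pM2l//; move: alQ; clear; lra.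
have QA'0 : 0 <= Q * A' by rewrite mulr_ge0// ltW.
have S9 : eta * (k * Q * l ^+ 2 * U + k * A' + Q * l * F' + g * X')
    <= 4^-1 * (k * Q * E) + 4^-1 * (al * k * A) + al / 4 * (k * A')
       + 6^-1 * (Q * A') + Q * (l * F') + c * (g * X).
  have S : k * Q * l ^+ 2 * U + k * A' + Q * l * F' + g * X' <=
      3 * (k * Q * E) + 3 * al * (al * k * A) + (3 * c ^+ 2 + 2) * (g * X)
      + k * A' + 2 * (Q * A') + Q * (l * F').
    have := ler_wpM2l g0 hX; move: S8 gA'; clear; lra.
  apply: le_trans (ler_wpM2l (ltW e0) S) _.
  have := ler_wpM2r T1 e1; have := ler_wpM2r T2 e3.
  have := ler_wpM2r T3 e4; have := ler_wpM2r T4 e2.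
  have e5 : eta <= 1 by move: e1; clear; lra.
  by have := ler_wpM2r T5 e5; have := ler_wpM2r QA'0 e1; move: T7; clear; lra.
have S10 : (26 + 20 * c + 32 / c) * (Q * (A + A')) <= al / 4 * (k * (A + A')).
  rewrite !mulrA; apply: ler_wpM2r => //; exact: addr_ge0.
have QA0 : 0 <= Q * A by rewrite mulr_ge0.
have cQA : 0 <= 32 / c * (Q * A).
  by apply: mulr_ge0 => //; apply: divr_ge0 => //; rewrite ler0n.
have cQA1 : 0 <= c * (Q * A) by rewrite mulr_ge0 ?(ltW al0).
have cQA' : 0 <= c * (Q * A') by rewrite mulr_ge0 ?(ltW al0).
have cgY : 0 <= c * (g * Y) by do 2![apply: mulr_ge0 => //].
have alA : 0 <= al * A by rewrite mulr_ge0 ?(ltW al0).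
(* The budget: for [g * X], the [16 * c / 4] of [S7] equals the [3 * c] of [S3] plus the [c] of
   [S9], whence the factor 16. The coefficients of [Q * A'] add up to less than
   [26 + 20 * c + 32 / c]; [S10] pays for them with half of the friction [al / 2 * k * (A + A')].
   The other half, and the [E] term of [S2], pay for the matching terms of [S9]. *)
move: hB S1 S2 S3 S4 S5 S6 S7 S9 S10 T5 T6 QA0 QA'0 cQA cQA1 cQA' cgY alA.
rewrite s1E; clear; lra.
Qed.

(** * One step of the recursion in an inner product space *)

Section InnerProduct.
Variables (R : realType) (H : lmodType R) (dot : {dot H for @idfun R}).
Implicit Types x y z d u : H.

Let dotC x y : dot x y = dot y x.
Proof. by rewrite hermC /= expr0 mul1r. Qed.

Let dotD x y z : (dot (x + y) z = dot x z + dot y z)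
  * (dot z (x + y) = dot z x + dot z y).
Proof. by rewrite linearDl linearDr. Qed.

Let dotN x z : (dot (- x) z = - dot x z) * (dot z (- x) = - dot z x).
Proof. by rewrite linearNl linearNr. Qed.

Let dotZ t x z : (dot (t *: x) z = t * dot x z) * (dot z (t *: x) = t * dot z x).
Proof. by rewrite linearZl_LR linearZr_LR. Qed.

Let dotE := (dotD, dotN, dotZ).

Let dot_ge0 x : 0 <= dot x x.
Proof.
have [->|x0] := eqVneq x 0; first by rewrite linear0l.
exact/ltW/neq0_dnorm_gt0.
Qed.

Let young (t : R) x y : 0 < t -> 2 * dot x y <= t * dot x x + t^-1 * dot y y.
Proof.
move=> t0; have := dot_ge0 (t *: x - y).
rewrite !dotE [dot y x]dotC.
have ti0 : 0 <= t^-1 by rewrite invr_ge0 ltW.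
move=> /(mulr_ge0 ti0); rewrite [leRHS](_ : _ =
  t * dot x x + t^-1 * dot y y - 2 * dot x y); last by field; rewrite gt_eqF.
by rewrite subr_ge0.
Qed.

(** The recursion is tested with [d'] and the products are polarized. The Tikhonov term is evaluated
    at the old point [x], which leaves the excess [c / 2 * |d'|^2]. *)
Lemma energy_step d d' x u (a l c F F' : R) :
  d' = (1 - a) *: d - l *: u - c *: x -> 0 <= l -> F' - F <= dot u d' ->
  2^-1 * dot d' d' + l * F' + c / 2 * dot (x + d') (x + d') <=
  2^-1 * dot d d + l * F + c / 2 * dot x x
  - (1 - a) / 2 * dot (d' - d) (d' - d)
  - a / 2 * (dot d d + dot d' d') + c / 2 * dot d' d'.
Proof.
move=> d'E l0 /(ler_wpM2l l0) hF.
have E : dot d' d' = (1 - a) * dot d d' - l * dot u d' - c * dot x d'.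
  by rewrite {1}d'E !dotE.
rewrite !dotE (dotC d' d) (dotC d' x).
lra.
Qed.

(** The recursion multiplied by [Q] is tested with [y + d'], the new displacement from the anchor.
    In the product with [d], the part [- al * <d, y>] is polarized; this is the increment of
    [al / 2 * |y|^2], since [y - d] is the previous displacement. *)
Lemma anchor_step d d' y z u (al l c Q Q' F' : R) :
  Q *: d' = (Q - al) *: d - (Q * l) *: u - (Q * c) *: (y + z) ->
  0 <= Q * l -> F' <= dot u (y + d') ->
  Q' * dot d' (y + d') + al / 2 * dot y y <=
  Q * dot d y + al / 2 * dot (y - d) (y - d)
  + (Q' - Q) * dot d' (y + d') + (Q - al) * dot d d' - al / 2 * dot d d
  - Q * l * F' - Q * c * dot (y + z) (y + d').
Proof.
move=> d'E l0 /(ler_wpM2l l0) hF.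
have E : Q * dot d' (y + d') = (Q - al) * dot d (y + d')
    - (Q * l) * dot u (y + d') - (Q * c) * dot (y + z) (y + d').
  by rewrite -(dotZ _ _ _).1 {1}d'E !dotE; ring.
move: E hF; rewrite !dotE (dotC d' y) (dotC d y).
lra.
Qed.

Let dot_add3 x y z : dot (x + y + z) (x + y + z) <=
  3 * dot x x + 3 * dot y y + 3 * dot z z.
Proof.
have := dot_ge0 (x - y); have := dot_ge0 (y - z); have := dot_ge0 (x - z).
rewrite !dotE [dot y x]dotC [dot z y]dotC [dot z x]dotC; lra.
Qed.

Lemma lyapunov_step d d' y z u (k Q Q' P al c l l' c' F F' eta : R) :
  d' = (1 - al / Q) *: d - l *: u - (c / P) *: (y + z) ->
  F' - F <= dot u d' -> F' <= dot u (y + d') -> 0 <= F' ->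
  1 <= k -> 1 <= Q -> Q <= Q' -> Q' <= Q + Q / k -> k <= P -> P <= k ^+ 2 ->
  0 < al -> 0 < c -> 0 <= l -> l' <= l -> c' <= c / P ->
  2 * al <= Q -> (26 + 20 * c + 32 / c) * Q <= al / 4 * k ->
  0 < eta -> eta <= 12^-1 -> eta <= 12^-1 * al -> 12 * al * eta <= 1 ->
  (3 * c ^+ 2 + 2) * eta <= c ->
  (k + 1) * Q' * (2^-1 * dot d' d' + l' * F'
                  + c' / 2 * dot (y + z + d') (y + z + d'))
  + 16 * (Q' * dot d' (y + d') + al / 2 * dot y y)
  + eta * (k * Q * l ^+ 2 * dot u u + k * dot d' d' + Q * l * F'
           + Q / P * dot (y + z + d') (y + z + d'))
  <= k * Q * (2^-1 * dot d d + l * F + c / P / 2 * dot (y + z) (y + z))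
     + 16 * (Q * dot d y + al / 2 * dot (y - d) (y - d))
     + 8 * c * (Q / P) * dot z z.
Proof.
move=> d'E hF hF' F'0 k1 Q1 QQ' Q'k kP Pk al0 c0 l0 l'l c'c alQ Ck e0 e1 e2 e3 e4.
have k0 : 0 < k by lra.
have Q0 : 0 < Q by lra.
have P0 : 0 < P by lra.
have cP0 : 0 <= c / P by rewrite divr_ge0// ltW.
have hE := energy_step d'E l0 hF.
have hA : Q *: d' = (Q - al) *: d - (Q * l) *: u - (Q * (c / P)) *: (y + z).
  rewrite {1}d'E !scalerBr !scalerA mulrBr mulr1.
  by rewrite (_ : Q * (al / Q) = al)//; field; rewrite gt_eqF.
have Ql0 : 0 <= Q * l by rewrite mulr_ge0// ltW.
have {}hA := anchor_step Q' hA Ql0 hF'.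
have t0 : 0 < c * k / (4 * P) by rewrite divr_gt0// mulr_gt0.
apply: (@lyapunov_scalar _ k Q Q' P al c l l' c' F F' eta (dot d d) _
  (dot (y + z) (y + z)) _ (dot y y) (dot z z) (dot (d' - d) (d' - d)) (dot u u)
  _ _ _ (dot d' (y + d')) (dot d d') (dot (y + z) (y + d')) (dot y d')) => //.
- by rewrite !dotE [dot d' y]dotC.
- exact: young.
- by have := dot_ge0 (d - d'); rewrite !dotE [dot d' d]dotC; lra.
(* Polarization gives [<y + z, y> = (X + Y - Z) / 2], and [<y + z, d'> >= - X / 4 - A'] is the
   nonnegativity of the square below. *)
- have := dot_ge0 (2^-1 *: (y + z) + d'); have := dot_ge0 d'.
  rewrite !dotE [dot z y]dotC [dot d' y]dotC [dot d' z]dotC.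
  lra.
- have := dot_ge0 (y + z - d').
  by rewrite !dotE [dot z y]dotC [dot d' y]dotC [dot d' z]dotC; lra.
- rewrite expr2 -mulrA -(dotZ l u u).2 -(dotZ l _ _).1.
  (* The subgradient is controlled by solving the recursion for [l *: u]. *)
  rewrite (_ : l *: u = (d - d') + (- (al / Q)) *: d + (- (c / P)) *: (y + z)).
    apply: le_trans (dot_add3 _ _ _) _.
    rewrite !dotE [dot d' d]dotC [dot z y]dotC; lra.
  rewrite !scaleNr [d - d' - _]addrAC [_ - d' - _]addrAC.
  by rewrite -{1}[d]scale1r -scalerBl {1}d'E opprB addrA subrK subKr.
Qed.

(** With [y = (y - d) + d], Young's inequality of weight [al / Q] lets [al / 2 * |y - d|^2] absorb
    the cross term up to [Q^2 / (2 al) * |d|^2]. Times 16, this is at most half of the kinetic term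
    [k * Q * |d|^2 / 2] once [32 * Q <= al * k]. *)
Lemma lyapunov_lower d y (k Q al G : R) :
  0 < k -> 0 < Q -> 0 < al -> 32 * Q <= al * k -> 0 <= G ->
  2^-1 * (k * Q * (2^-1 * dot d d + G)) <=
  k * Q * (2^-1 * dot d d + G) + 16 * (Q * dot d y + al / 2 * dot (y - d) (y - d)).
Proof.
move=> k0 Q0 al0 Qk G0.
have t0 : 0 < al / Q by rewrite divr_gt0.
have /(ler_wpM2l (ltW Q0)) := young (y - d) (- d) t0.
rewrite [leRHS](_ : _ = al * dot (y - d) (y - d) + Q * (Q / al) * dot d d).
  rewrite !dotE [dot d y]dotC => h.
  have kQG : 0 <= k * Q * G by rewrite !mulr_ge0// ltW.
  have QA : 0 <= Q * dot d d by rewrite mulr_ge0// ltW.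
  have : Q / al * (Q * dot d d) <= k / 32 * (Q * dot d d).
    by apply: ler_wpM2r => //; rewrite ler_pdivrMr//; lra.
  lra.
by rewrite !dotE; field; rewrite !gt_eqF.
Qed.

End InnerProduct.

(** * Powers and logarithms of consecutive integers *)

Section Powers.
Variable R : realType.
Implicit Types (a b e : R) (k n : nat).

Lemma powR_ge_eventually e (C : R) : 0 < e ->
  exists k0, forall k, (k0 <= k)%N -> C <= k%:R `^ e.
Proof.
move=> e0; exists (Num.bound (`|C| `^ e^-1)) => k kk.
apply: le_trans (ler_norm C) _.
have -> : `|C| = (`|C| `^ e^-1) `^ e by rewrite -powRrM mulVf ?powRr1// gt_eqF.
apply: ge0_ler_powR; rewrite ?nnegrE ?powR_ge0 ?ler0n ?(ltW e0)//.
apply/ltW/(@lt_le_trans _ _ (Num.bound (`|C| `^ e^-1))%:R).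
  exact/archi_boundP/powR_ge0.
by rewrite ler_nat.
Qed.

Lemma natr_powRD a b k : (0 < k)%N ->
  k%:R `^ (a + b) = k%:R `^ a * k%:R `^ b :> R.
Proof. by move=> k0; rewrite powRD// pnatr_eq0 -lt0n k0 implybT. Qed.

Lemma natr_powR_gt0 a k : (0 < k)%N -> 0 < k%:R `^ a :> R.
Proof. by move=> k0; rewrite powR_gt0 ?ltr0n. Qed.

Lemma powRS_le e : exists2 C : R, 0 < C &
  forall k, (0 < k)%N -> k.+1%:R `^ e <= C * k%:R `^ e.
Proof.
have [e0|e0] := leP 0 e.
  exists (2 `^ e); first by rewrite powR_gt0.
  move=> k k0; rewrite -powRM//.
  apply: ge0_ler_powR; rewrite ?nnegrE ?mulr_ge0//.
  by rewrite -natrM ler_nat mul2n -addnn -addn1 leq_add2l.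
exists 1 => // k k0; rewrite mul1r -[e]opprK !(powRN _ (- e)).
rewrite lef_pV2 ?posrE ?natr_powR_gt0//.
by apply: ge0_ler_powR; rewrite ?nnegrE ?ler_nat// oppr_ge0 ltW.
Qed.

Lemma natr_ler_powR a b k : (0 < k)%N -> a <= b -> k%:R `^ a <= k%:R `^ b :> R.
Proof. by move=> k0 ab; apply: ler_powR; rewrite ?ler1n. Qed.

Lemma powRS_decr e k : (0 < k)%N -> e <= 0 -> k.+1%:R `^ e <= k%:R `^ e :> R.
Proof.
move=> k0 e0; rewrite -[e]opprK !(powRN _ (- e)).
rewrite lef_pV2 ?posrE ?natr_powR_gt0//.
by apply: ge0_ler_powR; rewrite ?nnegrE ?ler_nat// oppr_ge0.
Qed.

(** This is [ln (1 + t) <= t] at [t = - 1 / (k + 1)]. *)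
Lemma lnS_ge k : (0 < k)%N -> k.+1%:R^-1 <= ln k.+1%:R - ln k%:R :> R.
Proof.
move=> k0; rewrite -ln_div ?posrE ?ltr0n//.
have := @le_ln1Dx R (- k.+1%:R^-1).
rewrite ltrN2 invf_lt1 ?ltr0n// ltr1n ltnS k0 => /(_ isT).
rewrite lerNr -lnV ?posrE ?subr_gt0 ?invf_lt1 ?ltr0n// ?ltr1n//.
rewrite (_ : (1 - k.+1%:R^-1)^-1 = k.+1%:R / k%:R)//.
by rewrite -natr1; field; rewrite pnatr_eq0 -lt0n k0 natr1 pnatr_eq0.
Qed.

(** The ratio of the powers is [exp (b * (ln (k + 1) - ln k))], to which [1 + t <= exp t] and
    [lnS_ge] apply. *)
Lemma powRS_ge b k : 0 < b -> (0 < k)%N ->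
  k%:R `^ b * (1 + b / k.+1%:R) <= k.+1%:R `^ b.
Proof.
move=> b0 k0; rewrite /powR !pnatr_eq0 (gtn_eqF k0)/=.
rewrite -[b * ln k.+1%:R](subrKC (b * ln k%:R)) expRD ler_wpM2l ?expR_ge0//.
apply: le_trans (expR_ge1Dx _); rewrite lerD2l -mulrBr.
by apply: ler_wpM2l; [exact: ltW|exact: lnS_ge].
Qed.

(** Discrete substitute for integrating [t^(b - 1)]: sums of such powers telescope. *)
Lemma powRS_diff_ge b k : 0 < b -> b <= 1 -> (0 < k)%N ->
  k.+1%:R `^ (b - 1) <= 2 / b * (k.+1%:R `^ b - k%:R `^ b).
Proof.
move=> b0 b1 k0; rewrite -(ler_pM2l (_ : 0 < b / 2)) ?divr_gt0//.
rewrite mulrA (_ : b / 2 * (2 / b) = 1) ?mul1r; last by field; rewrite gt_eqF.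
rewrite natr_powRD// powR_inv1// mulrCA.
have := powRS_ge b0 k0.
set h := b / _ in |- *.
have h0 : 0 < h by rewrite divr_gt0// ltr0n.
have h1 : h <= 1 by rewrite ler_pdivrMr ?ltr0n// mul1r (le_trans b1)// ler1n.
have : 0 <= k%:R `^ b :> R by rewrite powR_ge0.
rewrite (_ : b / 2 / _ = h / 2) ?[b / 2 / _]mulrAC//.
move: (k%:R `^ b) (k.+1%:R `^ b) => x y x0 xy.
(* Since [(2 - h) * (1 + h) = 2 + h * (1 - h) >= 2], this gives [2 * x <= (2 - h) * y], that is
   [h / 2 * y <= y - x]. *)
have : (2 - h) * (x * (1 + h)) <= (2 - h) * y by apply: ler_wpM2l => //; lra.
have : 0 <= x * (h * (1 - h)) by rewrite !mulr_ge0//; lra.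
lra.
Qed.

(** The decaying counterpart, from [powRS_ge] by inversion: the telescoped sums stay bounded. *)
Lemma powRS_diffN_ge b k : 0 < b -> (0 < k)%N ->
  k.+1%:R `^ (- b - 1) <= b^-1 * (k%:R `^ (- b) - k.+1%:R `^ (- b)).
Proof.
move=> b0 k0; rewrite -(ler_pM2l b0) mulrA divff ?gt_eqF// mul1r.
rewrite natr_powRD// powR_inv1//.
have : k.+1%:R `^ (- b) * (1 + b / k.+1%:R) <= k%:R `^ (- b) :> R.
  rewrite !powRN mulrC ler_pdivrMr ?natr_powR_gt0//.
  by rewrite ler_pdivlMl ?natr_powR_gt0//; exact: powRS_ge.
by move: (k.+1%:R `^ (- b)) (k%:R `^ (- b)) (k.+1%:R^-1) => x y z; lra.
Qed.

Lemma powR_leS e : exists2 C : R, 0 < C &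
  forall k, (0 < k)%N -> k%:R `^ e <= C * k.+1%:R `^ e.
Proof.
have [C C0 hC] := powRS_le (- e); exists C => // k k0.
rewrite -ler_pdivrMr ?natr_powR_gt0// mulrC -ler_pdivlMr ?natr_powR_gt0//.
by rewrite -!powRN hC.
Qed.

End Powers.

(** * Summation of a perturbed Lyapunov inequality *)

Section Lyapunov.
Variable R : realType.
Implicit Types (k n m : nat).

Lemma sum_le_telescope (F g : nat -> R) m n : (m <= n)%N ->
  (forall k, (m <= k)%N -> F k <= g k.+1 - g k) ->
  \sum_(m <= k < n) F k <= g n - g m.
Proof.
move=> mn Fg; rewrite -(@telescope_sumr _ m n g mn).
by apply: ler_sum_nat => k /andP[mk _]; exact: Fg.
Qed.

Variables (V T e : nat -> R) (k0 : nat).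
Hypotheses (V0 : forall k, (k0 <= k)%N -> 0 <= V k)
  (VT : forall k, (k0 <= k)%N -> V k.+1 + T k.+1 <= V k + e k).

(** Since [w] is nonincreasing and [V + T] nonnegative, [w k.+1 * (V k.+1 + T k.+1) <= w k * (V k +
    e k)]; induction sums this. *)
Lemma lyapunov_sum (w : nat -> R) n : (k0 <= n)%N ->
  (forall k, (k0 <= k)%N -> 0 <= w k.+1 <= w k) ->
  (forall k, (k0 <= k)%N -> 0 <= T k.+1) ->
  w n * V n + \sum_(k0 <= k < n) w k.+1 * T k.+1 <=
  w k0 * V k0 + \sum_(k0 <= k < n) w k * e k.
Proof.
move=> + w0 T0; elim: n => [|n IHn].
  by rewrite leqn0 => /eqP ->; rewrite !big_geq.
rewrite leq_eqVlt => /predU1P[<-|]; first by rewrite !big_geq.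
rewrite ltnS => kn; rewrite !big_nat_recr//=.
have /andP[wn0 wn] := w0 _ kn.
have := IHn kn; have := ler_wpM2l (le_trans wn0 wn) (VT kn).
have : w n.+1 * (V n.+1 + T n.+1) <= w n * (V n.+1 + T n.+1).
  by apply: ler_wpM2r => //; rewrite addr_ge0 ?T0// V0// leqW.
move: (\sum_(_ <= _ < _) _) (\sum_(_ <= _ < _) _) => a b.
lra.
Qed.

(** With weight 1 the forcing telescopes into [r], and the initial value [V k0] is absorbed as
    [V k0 / r k0 * r n] because [r] is nondecreasing. *)
Lemma lyapunov_rate (r : nat -> R) (C : R) :
  (forall k, (k0 <= k)%N -> 0 <= T k.+1) ->
  (forall k, (k0 <= k)%N -> e k <= C * (r k.+1 - r k)) ->
  0 <= C -> 0 < r k0 -> (forall k, (k0 <= k)%N -> r k <= r k.+1) ->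
  exists2 K, 0 < K & forall n, (k0 <= n)%N ->
    [/\ V n <= K * r n, T n.+1 <= K * r n.+1
      & \sum_(k0 <= k < n) T k.+1 <= K * r n].
Proof.
move=> T0 er C0 rk0 rS.
have rmono n : (k0 <= n)%N -> r k0 <= r n.
  move=> /subnK <-; elim: (n - k0)%N => // d IHd.
  by apply: le_trans IHd _; apply: rS; rewrite leq_addl.
pose K := V k0 / r k0 + C.
have K0 : 0 <= K by rewrite addr_ge0// divr_ge0 ?V0// ltW.
have main n : (k0 <= n)%N -> V n + \sum_(k0 <= k < n) T k.+1 <= K * r n.
  move=> kn.
  have := @lyapunov_sum (fun=> 1) n kn; rewrite ler01 lexx => /(_ (fun _ _ => isT) T0).
  rewrite (eq_bigr (fun k => T k.+1)) => [|k _]; last by rewrite mul1r.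
  rewrite [X in _ <= _ + X](eq_bigr e) => [|k _]; last by rewrite mul1r.
  rewrite !mul1r => /le_trans; apply.
  have : \sum_(k0 <= k < n) e k <= C * r n - C * r k0.
    by apply: (@sum_le_telescope _ (fun k => C * r k)) => // k kk; rewrite -mulrBr er.
  have : V k0 <= V k0 / r k0 * r n.
    rewrite -mulrA -[leLHS]mulr1; apply: ler_wpM2l; first exact: V0.
    by rewrite ler_pdivlMl// mulr1 rmono.
  have : 0 <= C * r k0 by rewrite mulr_ge0// ltW.
  rewrite /K; lra.
have S0 n : (k0 <= n)%N -> 0 <= \sum_(k0 <= k < n) T k.+1.
  by move=> kn; rewrite big_nat sumr_ge0// => k /andP[kk _]; exact: T0.
have r0 n : (k0 <= n)%N -> 0 <= r n by move=> /rmono; apply/le_trans/ltW.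
exists (K + 1) => [|n kn]; first by rewrite ltr_wpDl.
have := main _ kn; have := S0 _ kn; have := V0 kn; have := r0 _ kn.
have := main _ (leqW kn); have := V0 (leqW kn); have := r0 _ (leqW kn).
rewrite big_nat_recr//=.
move: (S0 _ kn); move: (\sum_(_ <= _ < _) _) => S *.
by split; lra.
Qed.

(** The weight [k^(- theta)] turns the forcing into [O(k^(- b - 1))] with [b = theta - a - 1 > 0],
    whose sums are bounded by telescoping [k^(- b)]. *)
Lemma lyapunov_summable (theta a C : R) :
  (0 < k0)%N ->
  (forall k, (k0 <= k)%N -> 0 <= T k.+1) -> 0 <= C ->
  (forall k, (k0 <= k)%N -> e k <= C * k%:R `^ a) ->
  0 <= theta -> a + 1 < theta ->
  exists K, forall n, (k0 <= n)%N ->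
    \sum_(k0 <= k < n) k.+1%:R `^ (- theta) * T k.+1 <= K.
Proof.
move=> k00 T0 C0 he th0 ath.
have kp k : (k0 <= k)%N -> (0 < k)%N by exact: leq_trans.
have [D D0 hD] := powR_leS (- (theta - a - 1) - 1 : R).
set b := theta - a - 1 in D D0 hD.
have b0 : 0 < b by rewrite /b; lra.
pose E := C * D * b^-1.
have E0 : 0 <= E by rewrite !mulr_ge0 ?invr_ge0// ltW.
exists (k0%:R `^ (- theta) * V k0 + E * k0%:R `^ (- b)) => n kn.
have := @lyapunov_sum (fun k => k%:R `^ (- theta)) n kn _ T0.
have w0 k : (k0 <= k)%N -> (0 : R) <= k.+1%:R `^ (- theta) <= k%:R `^ (- theta).
  by move=> kk; rewrite powR_ge0 powRS_decr ?kp// oppr_le0.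
move=> /(_ w0).
have : 0 <= n%:R `^ (- theta) * V n by rewrite mulr_ge0 ?powR_ge0 ?V0.
have : \sum_(k0 <= k < n) k%:R `^ (- theta) * e k <=
    - E * n%:R `^ (- b) - - E * k0%:R `^ (- b).
  apply: (@sum_le_telescope _ (fun k => - E * k%:R `^ (- b))) => // k kk.
  apply: (@le_trans _ _ (k%:R `^ (- theta) * (C * k%:R `^ a))).
    by apply: ler_wpM2l; rewrite ?powR_ge0 ?he.
  rewrite mulrCA -natr_powRD ?kp//.
  rewrite (_ : - theta + a = - b - 1); last by rewrite /b; ring.
  rewrite !mulNr opprK [leRHS]addrC -mulrBr /E -!mulrA; apply: ler_wpM2l => //.
  apply: le_trans (hD _ (kp _ kk)) _; apply: ler_wpM2l; first exact: ltW.
  exact: powRS_diffN_ge (kp _ kk).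
have : 0 <= E * n%:R `^ (- b) by rewrite mulr_ge0 ?powR_ge0.
move: (\sum_(_ <= _ < _) _) (\sum_(_ <= _ < _) _) => A B.
lra.
Qed.

End Lyapunov.

(** * The Lyapunov function along the iteration *)

(** The [T_k] of the overview; [U], [A], [F], [X] stand for [|u_k|^2], [|x_k - x_{k-1}|^2],
    [f(x_k) - min f], [|x_k|^2]. *)
Definition dissipation (R : realType) (q p delta : R) (U A F X : nat -> R)
    (k : nat) : R :=
  k%:R `^ (q + 1 + 2 * delta) * U k + k%:R * A k
  + k%:R `^ (q + delta) * F k + k%:R `^ (q - p) * X k.

(** Interface between the Hilbert space dynamics and the asymptotics: the lower bound on [V] yields
    pointwise rates, the perturbed decrease yields sums. *)
Definition energy_bound (R : realType) (q p delta : R) (U A F X : nat -> R) :=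
  exists (V : nat -> R) (k0 : nat) (eta C : R),
    [/\ (2 <= k0)%N, 0 < eta, 0 <= C &
    forall k, (k0 <= k)%N ->
      [/\ 0 <= V k,
          eta * (k%:R `^ (q + 1)
            * (A k + k%:R `^ delta * F k + k%:R `^ (- p) * X k)) <= V k &
          V k.+1 + eta * dissipation q p delta U A F X k.+1
            <= V k + C * k%:R `^ (q - p)]].

(** Finitely many smallness constraints are met at once by taking minima; [1 + a] in the witness
    avoids dividing by zero. *)
Lemma small_pos (R : realType) (s : seq (R * R)) :
  all (fun ab => (0 <= ab.1) && (0 < ab.2)) s ->
  exists2 eta : R, 0 < eta & all (fun ab => eta * ab.1 <= ab.2) s.
Proof.
elim: s => [|[a b] s IHs] /=; first by exists 1.
move=> /andP[/andP[a0 b0] s0]; have [eta e0 es] := IHs s0.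
have m0 : 0 < Num.min eta (b / (1 + a)).
  by rewrite lt_min e0 divr_gt0// ltr_pwDl.
exists (Num.min eta (b / (1 + a))) => //; apply/andP; split.
  apply: (@le_trans _ _ (b / (1 + a) * a)).
    by apply: ler_wpM2r => //; rewrite ge_min lexx orbT.
  rewrite mulrAC ler_pdivrMr ?ltr_pwDl//; lra.
apply/allP => ab abs; apply: le_trans (allP es _ abs).
have /andP[ab0 _] := allP s0 _ abs.
by apply: ler_wpM2r => //; rewrite ge_min lexx.
Qed.

(** [lyapunov_step] weights quantities of index [k + 1] by powers of [k]; passing to powers of
    [k + 1] costs constants. The bounds [4^-1], [lambda / 2], [c / 4] are half the weights in the
    energy, as the lower bound on [V] requires. *)
Lemma dissipation_shift (R : realType) (q p delta lambda eta1 c : R) :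
  q < p -> 0 < lambda -> 0 < eta1 -> 0 < c ->
  exists2 eta : R, 0 < eta & [/\ eta <= 4^-1, eta <= lambda / 2, eta <= c / 4
  & forall (U A F X : nat -> R) k, (0 < k)%N ->
    0 <= U k.+1 -> 0 <= A k.+1 -> 0 <= F k.+1 -> 0 <= X k.+1 ->
    eta * dissipation q p delta U A F X k.+1 <=
    eta1 * (k%:R * k%:R `^ q * (lambda * k%:R `^ delta) ^+ 2 * U k.+1
      + k%:R * A k.+1 + k%:R `^ q * (lambda * k%:R `^ delta) * F k.+1
      + k%:R `^ q / k%:R `^ p * X k.+1)].
Proof.
move=> qp l0 e0 c0.
have [C1 C10 h1] := powRS_le (q + 1 + 2 * delta).
have [C2 C20 h2] := powRS_le (q + delta).
have ll0 : 0 < lambda ^+ 2 by rewrite exprn_gt0.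
have [|eta eta0] := @small_pos _ [:: (1, 4^-1); (1, lambda / 2); (1, c / 4);
  (C1, eta1 * lambda ^+ 2); (C2, eta1 * lambda); (2, eta1); (1, eta1)].
  by rewrite /= !ler01 ler0n (ltW C10) (ltW C20) e0 !mulr_gt0 ?invr_gt0// ltr0n.
rewrite /= andbT !mulr1 => /and4P[e1 e2 e3 /and4P[e4 e5 e6 e7]].
exists eta => //; split => // U A F X k k0 U0 A0 F0 X0.
have kr : 0 < k%:R :> R by rewrite ltr0n.
rewrite /dissipation !mulrDr; apply: lerD; first apply: lerD; first apply: lerD.
- rewrite !mulrA; apply: ler_wpM2r => //.
  apply: (@le_trans _ _ (eta * (C1 * k%:R `^ (q + 1 + 2 * delta)))).
    by apply: ler_wpM2l; [exact: ltW|exact: h1].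
  rewrite mulrA; apply: le_trans (ler_wpM2r (powR_ge0 _ _) e4) _.
  rewrite (_ : q + 1 + 2 * delta = 1 + q + delta + delta); last by ring.
  by rewrite !natr_powRD// powRr1 ?ler0n// le_eqVlt; apply/orP; left; apply/eqP; ring.
- rewrite !mulrA; apply: ler_wpM2r => //.
  apply: (@le_trans _ _ (eta * (2 * k%:R))).
    apply: ler_wpM2l; first exact: ltW.
    by rewrite -natrM ler_nat mul2n -addnn -addn1 leq_add2l.
  by rewrite mulrA; apply: ler_wpM2r => //; exact: ltW.
- rewrite !mulrA; apply: ler_wpM2r => //.
  apply: (@le_trans _ _ (eta * (C2 * k%:R `^ (q + delta)))).
    by apply: ler_wpM2l; [exact: ltW|exact: h2].
  rewrite mulrA; apply: le_trans (ler_wpM2r (powR_ge0 _ _) e5) _.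
  by rewrite natr_powRD// !mulrA [eta1 * _ * lambda]mulrAC.
- rewrite !mulrA; apply: ler_wpM2r => //.
  rewrite -mulrA -powRN -natr_powRD//; apply: ler_pM; rewrite ?powR_ge0 ?(ltW eta0)//.
  by apply: powRS_decr => //; rewrite subr_le0 ltW.
Qed.

Lemma powRS_le1D (R : realType) (q : R) k : (0 < k)%N -> 0 <= q -> q <= 1 ->
  k.+1%:R `^ q <= k%:R `^ q + k%:R `^ q / k%:R :> R.
Proof.
move=> k0 q0 q1; have kr : 0 < k%:R :> R by rewrite ltr0n.
have -> : k.+1%:R = k%:R * (1 + k%:R^-1) :> R.
  by rewrite -natr1; field; rewrite gt_eqF.
have i0 : 0 <= k%:R^-1 :> R by rewrite invr_ge0 ltW.
rewrite powRM ?addr_ge0 ?(ltW kr)//.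
rewrite (_ : _ + _ / _ = k%:R `^ q * (1 + k%:R^-1)); last first.
  by rewrite mulrDr mulr1.
apply: ler_wpM2l; first exact: powR_ge0.
rewrite -[leRHS]powRr1 ?addr_ge0//; apply: ler_powR => //.
by rewrite lerDl.
Qed.

Lemma energy_decay (R : realType) (H : lmodType R) (dot : {dot H for @idfun R})
    (alpha c q p lambda delta : R) (x u : nat -> H) (z : H) (F : nat -> R) :
  0 < alpha -> 0 < c -> 0 < q -> q < 1 -> 1 < p -> p <= q + 1 ->
  0 < lambda -> delta <= 0 ->
  (forall k, (1 <= k)%N -> x k.+1 - x k =
    (1 - alpha / k%:R `^ q) *: (x k - x k.-1)
    - (lambda * k%:R `^ delta) *: u k.+1 - (c / k%:R `^ p) *: x k) ->
  (forall k, (2 <= k)%N -> 0 <= F k) ->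
  (forall k, (2 <= k)%N -> F k.+1 - F k <= dot (u k.+1) (x k.+1 - x k)) ->
  (forall k, (2 <= k)%N -> F k.+1 <= dot (u k.+1) (x k.+1 - z)) ->
  let U k := dot (u k) (u k) in
  let A k := dot (x k - x k.-1) (x k - x k.-1) in
  let X k := dot (x k) (x k) in
  energy_bound q p delta U A F X.
Proof.
move=> al0 c0 q0 q1 p1 pq l0 d0 xS F0 hF hFz U A X.
have qp : q < p by lra.
have [|eta1 eta10] := @small_pos R [:: (12, 1); (12, alpha); (12 * alpha, 1);
    (3 * c ^+ 2 + 2, c)].
  have h3 : 0 <= 3 * c ^+ 2 + 2 by rewrite addr_ge0 ?ler0n// mulr_ge0 ?ler0n ?sqr_ge0.
  have h12 : 0 <= 12 * alpha by rewrite mulr_ge0 ?ler0n// ltW.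
  by rewrite /= c0 al0 ltr01 !ler0n h3 h12.
rewrite /= andbT => /and4P[e1 e2 e3 e4].
have [eta eta0 [g1 g2 g3 hT]] := dissipation_shift delta qp l0 eta10 c0.
pose M := (26 + 20 * c + 32 / c).
have M0 : 26 <= M.
  have : 0 < 32 / c by rewrite divr_gt0.
  by rewrite /M; lra.
(* Beyond [k1] the inertial coefficient is at least 1/2; beyond [k2], [M * k^q <= alpha / 4 * k],
   which is possible because [q < 1]. These are the largeness conditions of [lyapunov_step]. *)
have [k1 hk1] := powR_ge_eventually (2 * alpha) q0.
have q10 : 0 < 1 - q by lra.
have [k2 hk2] := powR_ge_eventually (M / (alpha / 4)) q10.
pose V k := k%:R * k%:R `^ q * (2^-1 * A k + (lambda * k%:R `^ delta) * F k
    + c / k%:R `^ p / 2 * X k)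
  + 16 * (k%:R `^ q * dot (x k - x k.-1) (x k - z)
    + alpha / 2 * dot (x k - z - (x k - x k.-1)) (x k - z - (x k - x k.-1))).
exists V, (maxn 2 (maxn k1 k2)), eta, (8 * c * dot z z).
have zz0 : 0 <= dot z z.
  have [->|z0] := eqVneq z 0; first by rewrite linear0l.
  exact/ltW/neq0_dnorm_gt0.
have dot_ge0 y : 0 <= dot y y.
  have [->|y0] := eqVneq y 0; first by rewrite linear0l.
  exact/ltW/neq0_dnorm_gt0.
split => //; [exact: leq_maxl|by rewrite !mulr_ge0 ?ler0n ?(ltW c0)|].
move=> k; rewrite !geq_max => /and3P[k_2 kk1 kk2].
have k_0 : (0 < k)%N by apply: leq_trans k_2.
have kr1 : 1 <= k%:R :> R by rewrite ler1n.
have kr0 : 0 < k%:R :> R by rewrite ltr0n.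
have Q1 : 1 <= k%:R `^ q :> R.
  by rewrite -[leLHS](powRr0 k%:R); apply: ler_powR => //; exact: ltW.
have Q0 : 0 < k%:R `^ q :> R := lt_le_trans ltr01 Q1.
have Q2 : 2 * alpha <= k%:R `^ q.
  exact: hk1.
have MQ : M * k%:R `^ q <= alpha / 4 * k%:R.
  have := hk2 k kk2.
  rewrite ler_pdivrMr ?divr_gt0// => /(ler_wpM2r (ltW Q0)).
  rewrite mulrAC -natr_powRD// subrK powRr1 ?(ltW kr0)//.
  by rewrite [_ * (alpha / 4)]mulrC.
have LF : 0 <= (lambda * k%:R `^ delta) * F k.
  by rewrite !mulr_ge0 ?F0 ?powR_ge0 ?(ltW l0).
have cP : 0 <= c / k%:R `^ p / 2 by rewrite !divr_ge0 ?powR_ge0 ?(ltW c0).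
have G0 : 0 <= (lambda * k%:R `^ delta) * F k + c / k%:R `^ p / 2 * X k.
  by rewrite addr_ge0// mulr_ge0// dot_ge0.
have kQ0 : 0 <= k%:R * k%:R `^ q :> R by rewrite mulr_ge0 ?(ltW kr0) ?(ltW Q0).
have Vlow : 2^-1 * (k%:R * k%:R `^ q * (2^-1 * A k
    + (lambda * k%:R `^ delta) * F k + c / k%:R `^ p / 2 * X k)) <= V k.
  rewrite /V -addrA; apply: lyapunov_lower => //.
  have := ler_wpM2r (ltW Q0) M0; have := mulr_gt0 al0 kr0; lra.
have lower : eta * (k%:R `^ (q + 1)
    * (A k + k%:R `^ delta * F k + k%:R `^ (- p) * X k)) <= V k.
  apply: le_trans Vlow; rewrite natr_powRD// powRr1 ?(ltW kr0)// powRN.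
  rewrite [k%:R `^ q * _]mulrC mulrCA [leRHS]mulrCA; apply: ler_wpM2l => //.
  rewrite !mulrDr; apply: lerD; first apply: lerD.
  - by rewrite mulrA; apply: ler_wpM2r; [exact: dot_ge0|lra].
  - rewrite !mulrA; apply: ler_wpM2r; first exact: F0.
    by apply: ler_wpM2r; [exact: powR_ge0|lra].
  - rewrite !mulrA; apply: ler_wpM2r; first exact: dot_ge0.
    rewrite [leRHS](_ : _ = c / 4 / k%:R `^ p); last first.
      by field; rewrite gt_eqF// natr_powR_gt0.
    by apply: ler_wpM2r => //; rewrite invr_ge0 powR_ge0.
split => //.
  apply: le_trans lower; rewrite mulr_ge0 ?(ltW eta0)// mulr_ge0 ?powR_ge0//.
  by rewrite !addr_ge0 ?mulr_ge0 ?powR_ge0 ?F0 ?dot_ge0.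
have := hT U A F X k k_0 (dot_ge0 _) (dot_ge0 _) (F0 _ (leqW k_2)) (dot_ge0 _).
rewrite -(lerD2l (V k.+1)) => /le_trans; apply.
rewrite [8 * c * _ * _]mulrAC natr_powRD// powRN.
have dE : x k.+1 - z - (x k.+1 - x k) = x k - z.
  by rewrite opprB addrC subrKA.
have yE : x k - z + (x k.+1 - x k) = x k.+1 - z by rewrite addrC subrKA.
have Pgt0 : 0 < k%:R `^ p :> R by rewrite natr_powR_gt0.
have := @lyapunov_step R H dot (x k - x k.-1) (x k.+1 - x k) (x k - z) z (u k.+1)
  k%:R (k%:R `^ q) (k.+1%:R `^ q) (k%:R `^ p) alpha c (lambda * k%:R `^ delta)
  (lambda * k.+1%:R `^ delta) (c / k.+1%:R `^ p) (F k) (F k.+1) eta1.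
rewrite subrK yE subrKC natr1 => step.
rewrite /V dE; apply: step => //.
- exact: xS.
- exact: hF.
- exact: hFz.
- exact/F0/leqW.
- by apply: ge0_ler_powR; rewrite ?nnegrE ?ler_nat ?ler0n// ltW.
- by apply: powRS_le1D; rewrite ?ltW.
- by rewrite -[leLHS]powRr1 ?(ltW kr0)//; apply: natr_ler_powR => //; exact: ltW.
- by rewrite -powR_mulrn ?(ltW kr0)//; apply: natr_ler_powR => //; lra.
- by rewrite mulr_ge0 ?powR_ge0 ?(ltW l0).
- by apply: ler_wpM2l; [exact: ltW|exact: powRS_decr].
- by apply: ler_wpM2l; [exact: ltW|rewrite -!powRN powRS_decr// oppr_le0; lra].
- lra.
- lra.
- by rewrite mulrC.
- by rewrite mulrC.
Qed.

(** * From eventual bounds to limsups, O-estimates and series *)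

Section Limits.
Variable R : realType.
Implicit Types (k m n : nat).

Lemma limn_esup_lty (u : nat -> \bar R) (C : R) k0 :
  (forall n, (k0 <= n)%N -> (u n <= C%:E)%E) -> (limn_esup u < +oo)%E.
Proof.
move=> uC; apply: (@le_lt_trans _ _ C%:E); last exact: ltry.
apply: (@le_trans _ _ (ereal_sup (u @` [set n | (k0 <= n)%N]))).
  by apply: ereal_inf_lbound; exists [set n | (k0 <= n)%N] => //; exists k0.
by apply: ge_ereal_sup => _ [n /= kn <-]; exact: uC.
Qed.

Lemma eqO_eventually (f g : nat -> R) (C : R) k0 :
  (forall k, (k0 <= k)%N -> `|f k| <= C * g k) -> f =O_\oo g.
Proof.
move=> fg; apply/eqOP; near=> K.
exists k0 => // k /= kk; apply: le_trans (fg _ kk) _.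
apply: le_trans (ler_norm _) _; rewrite normrM; apply: ler_wpM2r => //.
Unshelve. all: by end_near. Qed.

Lemma sum_head_le (t T : nat -> R) (M : R) m k0 : (m <= k0)%N ->
  (forall k, (m <= k)%N -> 0 <= t k) ->
  (forall k, (k0 <= k)%N -> t k <= M * T k) ->
  exists2 B, 0 <= B & forall n, (k0 <= n)%N ->
    \sum_(m <= k < n.+1) t k <= B + M * \sum_(k0 <= k < n.+1) T k.
Proof.
move=> mk t0 tT; exists (\sum_(m <= k < k0) t k).
  by rewrite big_nat sumr_ge0// => k /andP[mk' _]; exact: t0.
move=> n kn; rewrite (big_cat_nat mk)//= ?(leqW kn)// lerD2l big_distrr/=.
by apply: ler_sum_nat => k /andP[kk _]; exact: tT.
Qed.

Lemma nneseries_lty (t : nat -> R) (C : R) m k0 :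
  (forall k, (m <= k)%N -> 0 <= t k) ->
  (forall n, (k0 <= n)%N -> \sum_(m <= k < n.+1) t k <= C) ->
  (\sum_(m <= k <oo) (t k)%:E < +oo)%E.
Proof.
move=> t0 tC; apply: (@le_lt_trans _ _ C%:E); last exact: ltry.
apply: lime_le.
  by apply: is_cvg_nneseries_cond => k mk _; rewrite lee_fin t0.
exists k0.+1 => // -[//|n] /= kn.
by rewrite sumEFin lee_fin; exact: tC.
Qed.
Lemma bounded_eventually (V : normedModType R) (f : nat -> V) (B : R) k0 :
  (forall k, (k0 <= k)%N -> `|f k| <= B) -> bounded_fun f.
Proof.
move=> fB; pose S := \sum_(k < k0) `|f k|.
exists (S + `|B|); split; first exact: num_real.
move=> M SM k _ /=; apply: le_trans (ltW SM).
have S0 : 0 <= S by rewrite sumr_ge0.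
have [kk|kk] := leqP k0 k.
  by apply: le_trans (fB _ kk) _; apply: le_trans (ler_norm B) _; rewrite lerDr.
apply: (@le_trans _ _ S); last by rewrite lerDl.
by rewrite /S (bigD1 (Ordinal kk))//= lerDl sumr_ge0.
Qed.
End Limits.

(** * Rates and summability drawn from the energy bound *)

Section Rates.
Variables (R : realType) (q p delta : R) (U A F X : nat -> R).
Hypothesis bound : energy_bound q p delta U A F X.
Hypotheses (U0 : forall k, (2 <= k)%N -> 0 <= U k)
  (A0 : forall k, 0 <= A k) (F0 : forall k, (2 <= k)%N -> 0 <= F k)
  (X0 : forall k, 0 <= X k).

Local Notation T := (dissipation q p delta U A F X).

Lemma dissipation_ge k : (2 <= k)%N ->
  [/\ 0 <= T k, k%:R `^ (q + 1 + 2 * delta) * U k <= T k, k%:R * A k <= T k &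
    k%:R `^ (q + delta) * F k <= T k].
Proof.
move=> k2; rewrite /dissipation.
have h1 : 0 <= k%:R `^ (q + 1 + 2 * delta) * U k by rewrite mulr_ge0 ?powR_ge0 ?U0.
have h2 : 0 <= k%:R * A k by rewrite mulr_ge0 ?ler0n ?A0.
have h3 : 0 <= k%:R `^ (q + delta) * F k by rewrite mulr_ge0 ?powR_ge0 ?F0.
have h4 : 0 <= k%:R `^ (q - p) * X k by rewrite mulr_ge0 ?powR_ge0 ?X0.
by split; lra.
Qed.

Section Rate.
Variables (r : nat -> R) (C' : R).
Hypotheses (C'0 : 0 < C')
  (hr : forall k, (2 <= k)%N -> k%:R `^ (q - p) <= C' * (r k.+1 - r k))
  (r0 : forall k, (2 <= k)%N -> 0 < r k).

Let rS k : (2 <= k)%N -> r k <= r k.+1.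
Proof.
by move=> /hr/(le_trans (powR_ge0 _ _)); rewrite pmulr_rge0// subr_ge0.
Qed.

(** Here [r] acts as a discrete primitive of the forcing [k^(q - p)]: it will be [k^(q + 1 - p)] if
    [p < q + 1] and [ln k] if [p = q + 1]. *)
Lemma energy_rates :
  exists K k1, [/\ 0 < K, (3 <= k1)%N & forall n, (k1 <= n)%N ->
    [/\ n%:R `^ (q + 1) * (A n + n%:R `^ delta * F n + n%:R `^ (- p) * X n) <= K * r n,
      n%:R `^ (q + 1 + 2 * delta) * U n <= K * r n
    & \sum_(k1 <= k < n.+1) T k <= K * r n]].
Proof.
have [V [k0 [eta [C [k02 eta0 C0 hV]]]]] := bound.
have k2 k : (k0 <= k)%N -> (2 <= k)%N by exact: leq_trans.
have V0 k : (k0 <= k)%N -> 0 <= V k by move=> /hV[].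
have VT k : (k0 <= k)%N -> V k.+1 + eta * T k.+1 <= V k + C * k%:R `^ (q - p).
  by move=> /hV[].
have T0 k : (k0 <= k)%N -> 0 <= eta * T k.+1.
  move=> kk; rewrite mulr_ge0 ?(ltW eta0)//.
  by have [] := dissipation_ge (k2 _ (leqW kk)).
have er k : (k0 <= k)%N -> C * k%:R `^ (q - p) <= C * C' * (r k.+1 - r k).
  by move=> kk; rewrite -mulrA; apply: ler_wpM2l => //; exact/hr/k2.
have CC0 : 0 <= C * C' by rewrite mulr_ge0// ltW.
have [K K0 hK] := lyapunov_rate (T := fun k => eta * T k) V0 VT T0 er CC0 (r0 k02)
  (fun k kk => rS (k2 k kk)).
(* The start moves to [k0.+1] because the decrease at [k] controls the dissipation at [k.+1]. *)
exists (K / eta), k0.+1; split; first by rewrite divr_gt0.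
  exact: k02.
case=> // n; rewrite ltnS => kn.
have [_ h2 _] := hK _ kn; have [h4 _ h3] := hK _ (leqW kn).
have [_ h5 _] := hV _ (leqW kn).
rewrite mulrAC; split; rewrite ler_pdivlMr// mulrC.
- exact: le_trans h5 h4.
- apply: le_trans h2; apply: ler_wpM2l; first exact: ltW.
  by have [] := dissipation_ge (k2 _ (leqW kn)).
- rewrite big_add1/= big_distrr/=; exact: h3.
Qed.

(** For [r k = k^(q + 1 - p)] the bound on [X] is constant, hence the boundedness of the
    iterates. *)
Lemma energy_pointwise : exists K k1, [/\ 0 < K, (3 <= k1)%N &
  forall k, (k1 <= k)%N ->
  [/\ F k <= K * (r k * k%:R `^ (- (q + 1) - delta)),
      A k <= K * (r k * k%:R `^ (- (q + 1))),
      U k <= K * (r k * k%:R `^ (- (q + 1) - 2 * delta)) &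
      X k <= K * (r k * k%:R `^ (p - (q + 1)))]].
Proof.
have [K [k1 [K0 k13 hK]]] := energy_rates; exists K, k1; split => // k kk.
have k2 : (2 <= k)%N := ltnW (leq_trans k13 kk).
have k0 : (0 < k)%N := ltnW k2.
have [h1 h2 _] := hK _ kk.
have key e y : k%:R `^ e * y <= K * r k -> y <= K * (r k * k%:R `^ (- e)).
  by move=> h; rewrite mulrA powRN ler_pdivlMr ?natr_powR_gt0// mulrC.
have a1 : 0 <= k%:R `^ (q + 1) * A k by rewrite mulr_ge0 ?powR_ge0.
have a2 : 0 <= k%:R `^ (q + 1) * (k%:R `^ delta * F k).
  by rewrite !mulr_ge0 ?powR_ge0 ?F0.
have a3 : 0 <= k%:R `^ (q + 1) * (k%:R `^ (- p) * X k).
  by rewrite !mulr_ge0 ?powR_ge0.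
rewrite !mulrDr in h1; split.
- rewrite -opprD; apply: key; rewrite natr_powRD// -mulrA.
  by apply: le_trans h1; rewrite -addrA addrCA lerDl addr_ge0.
- by apply: key; apply: le_trans h1; rewrite -addrA lerDl addr_ge0.
- by rewrite -opprD; apply: key.
- rewrite -opprB; apply: key; rewrite natr_powRD// -mulrA.
  by apply: le_trans h1; rewrite lerDr addr_ge0.
Qed.

(** The terms before [k1] add up to a constant, absorbed through [r n >= r 2 > 0]. *)
Lemma energy_sum_rate (t : nat -> R) (M : R) m : (m <= 3)%N -> 0 <= M ->
  (forall k, (m <= k)%N -> 0 <= t k) -> (forall k, (3 <= k)%N -> t k <= M * T k) ->
  exists C k1, (3 <= k1)%N /\
    forall n, (k1 <= n)%N -> \sum_(m <= k < n.+1) t k <= C * r n.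
Proof.
move=> m3 M0 t0 tT; have [K [k1 [K0 k13 hK]]] := energy_rates.
have [B B0 hB] := sum_head_le (leq_trans m3 k13) t0
  (fun k kk => tT k (leq_trans k13 kk)).
exists (B / r 2 + M * K), k1; split => // n kn; apply: le_trans (hB _ kn) _.
rewrite mulrDl; apply: lerD; last first.
  by rewrite -mulrA; apply: ler_wpM2l => //; have [] := hK _ kn.
rewrite mulrAC ler_pdivlMr ?r0//; apply: ler_wpM2l => //.
have /subnK <- : (2 <= n)%N := ltnW (leq_trans k13 kn).
elim: (n - 2)%N => // d IHd; apply: le_trans IHd _.
by rewrite addSn; apply: rS; rewrite leq_addl.
Qed.

Lemma energy_limsup (t : nat -> R) (M : R) m : (m <= 3)%N -> 0 <= M ->
  (forall k, (m <= k)%N -> 0 <= t k) -> (forall k, (3 <= k)%N -> t k <= M * T k) ->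
  (limn_esup (fun n => ((\sum_(m <= k < n.+1) t k) / r n)%:E) < +oo)%E.
Proof.
move=> m3 M0 t0 tT; have [C [k1 [k13 hC]]] := energy_sum_rate m3 M0 t0 tT.
apply: (@limn_esup_lty _ _ C k1) => n kn.
rewrite lee_fin ler_pdivrMr ?hC// r0//.
exact: ltnW (leq_trans k13 kn).
Qed.

End Rate.

(** [lyapunov_summable] with [a = q - p] and [theta = q + 1 - 2 * s]: the condition [a + 1 < theta]
    is exactly [2 * s < p]. *)
Lemma energy_summable (s : R) : 2 * s < p -> p <= q + 1 ->
  exists K k1, (3 <= k1)%N /\ forall n, (k1 <= n)%N ->
    \sum_(k1 <= k < n.+1) k%:R `^ (2 * s - q - 1) * T k <= K.
Proof.
move=> sp pq; have [V [k0 [eta [C [k02 eta0 C0 hV]]]]] := bound.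
have k2 k : (k0 <= k)%N -> (2 <= k)%N by exact: leq_trans.
have V0 k : (k0 <= k)%N -> 0 <= V k by move=> /hV[].
have VT k : (k0 <= k)%N -> V k.+1 + eta * T k.+1 <= V k + C * k%:R `^ (q - p).
  by move=> /hV[].
have T0 k : (k0 <= k)%N -> 0 <= eta * T k.+1.
  move=> kk; rewrite mulr_ge0 ?(ltW eta0)//.
  by have [] := dissipation_ge (k2 _ (leqW kk)).
have th0 : 0 <= q + 1 - 2 * s by lra.
have th1 : q - p + 1 < q + 1 - 2 * s by lra.
have [K hK] := lyapunov_summable (T := fun k => eta * T k) V0 VT
  (ltnW k02) T0 C0 (fun _ _ => lexx _) th0 th1.
exists (K / eta), k0.+1; split => // -[//|n]; rewrite ltnS => kn.
rewrite ler_pdivlMr// mulrC big_add1/= big_distrr/=.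
apply: le_trans (hK _ (leqW kn)); rewrite le_eqVlt; apply/orP; left; apply/eqP.
apply: eq_bigr => k _; rewrite mulrCA; congr (_ `^ _ * _); ring.
Qed.

Lemma energy_series (s : R) (t : nat -> R) (M : R) m :
  2 * s < p -> p <= q + 1 -> (m <= 3)%N -> 0 <= M ->
  (forall k, (m <= k)%N -> 0 <= t k) ->
  (forall k, (3 <= k)%N -> t k <= M * (k%:R `^ (2 * s - q - 1) * T k)) ->
  (\sum_(m <= k <oo) (t k)%:E < +oo)%E.
Proof.
move=> sp pq m3 M0 t0 tT; have [K [k1 [k13 hK]]] := energy_summable sp pq.
have [B B0 hB] := sum_head_le (leq_trans m3 k13) t0
  (fun k kk => tT k (leq_trans k13 kk)).
apply: (@nneseries_lty _ _ (B + M * K) m k1) => // n kn.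
apply: le_trans (hB _ kn) _; rewrite lerD2l; apply: ler_wpM2l => //.
exact: hK.
Qed.

End Rates.

(** * The two comparison functions, and passage to the final forms *)

Lemma rate_powR (R : realType) (b : R) : 0 < b -> b <= 1 ->
  exists2 C : R, 0 < C & forall k, (2 <= k)%N ->
    k%:R `^ (b - 1) <= C * (k.+1%:R `^ b - k%:R `^ b).
Proof.
move=> b0 b1; have [D D0 hD] := powR_leS (b - 1).
exists (D * (2 / b)) => [|k k2]; first by rewrite mulr_gt0// divr_gt0.
have k0 : (0 < k)%N by exact: ltnW.
apply: le_trans (hD _ k0) _; rewrite -[leRHS]mulrA.
by apply: ler_wpM2l; [exact: ltW|exact: powRS_diff_ge].
Qed.

Lemma rate_ln (R : realType) : exists2 C : R, 0 < C & forall k, (2 <= k)%N ->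
    k%:R `^ (-1) <= C * (ln k.+1%:R - ln k%:R).
Proof.
have [D D0 hD] := @powR_leS R (-1).
exists D => // k k2; have k0 : (0 < k)%N by exact: ltnW.
apply: le_trans (hD _ k0) _; apply: ler_wpM2l; first exact: ltW.
by rewrite powR_inv1 ?ler0n// lnS_ge.
Qed.

(** [K <= (K + 1) ^+ 2] provides a constant without extracting a root. *)
Lemma eqO_sqr (R : realType) (f g : nat -> R) (K : R) k0 : 0 <= K ->
  (forall k, 0 <= f k) -> (forall k, 0 <= g k) ->
  (forall k, (k0 <= k)%N -> f k ^+ 2 <= K * g k ^+ 2) -> f =O_\oo g.
Proof.
move=> K0 f0 g0 fg; apply: (@eqO_eventually _ _ _ (K + 1) k0) => k kk.
rewrite ger0_norm// -ler_sqr ?nnegrE ?mulr_ge0 ?addr_ge0//.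
apply: le_trans (fg _ kk) _; rewrite exprMn; apply: ler_wpM2r.
  exact: sqr_ge0.
have := sqr_ge0 K; lra.
Qed.

(** Setting [j = k - 1] pairs [w j.+1] with [s j] for [j < n]; the nonnegative term [j = n] is then
    added to reach the sum in the bound. *)
Lemma limn_esup_weighted (R : realType) (w s r : nat -> R) (a : nat -> \bar R)
    (C : R) k1 :
  (forall k, 0 <= w k) -> (forall j, (2 <= j)%N -> 0 <= s j) ->
  (forall j, (2 <= j)%N -> (a j <= (s j)%:E)%E) ->
  (forall n, (k1 <= n)%N -> 0 < r n) ->
  (forall n, (k1 <= n)%N -> \sum_(2 <= j < n.+1) w j.+1 * s j <= C * r n) ->
  (limn_esup (fun n => (\sum_(3 <= k < n.+1) (w k)%:E * a k.-1)
     * ((r n)^-1)%:E) < +oo)%E.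
Proof.
move=> w0 s0 as_ r0 hC; apply: (@limn_esup_lty _ _ C k1) => n kn.
have rn := r0 _ kn.
apply: (@le_trans _ _ ((\sum_(2 <= j < n.+1) w j.+1 * s j)%:E * ((r n)^-1)%:E)%E).
  apply: lee_wpmul2r; first by rewrite lee_fin invr_ge0 ltW.
  rewrite big_add1/= -sumEFin.
  apply: (@le_trans _ _ (\sum_(2 <= j < n) (w j.+1 * s j)%:E)%E).
    rewrite big_nat [leRHS]big_nat; apply: lee_sum => j /andP[j2 _].
    by rewrite EFinM; apply: lee_wpmul2l; [rewrite lee_fin|exact: as_].
  have [n2|n2] := leqP 2 n.
    rewrite (big_nat_recr n)//= leeDl// lee_fin mulr_ge0 ?s0//.
  by rewrite !big_geq// ltnW.
by rewrite -EFinM lee_fin ler_pdivrMr// hC.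
Qed.

(** * Finiteness of the values of [f] *)

Section Subgradients.
Variables (R : realType) (H : completeNormedModType R).
Variables (dot : {dot H for @idfun R}) (f : H -> \bar R).
Hypothesis f_proper : proper_fun f.

Lemma min_valE z : argmin f z -> min_val f = f z.
Proof.
move=> fz; apply/eqP; rewrite eq_le; apply/andP; split.
  by apply: ereal_inf_lbound; exists z.
by apply: le_ereal_inf_tmp => _ [y _ <-]; exact: fz.
Qed.

Lemma argmin_fin_num z : argmin f z -> f z \is a fin_num.
Proof.
have [fNy [y fy]] := f_proper; move=> fz.
rewrite fin_numE fNy -ltey; apply: le_lt_trans (fz y) _.
by rewrite ltey.
Qed.

(** If [f x] were [+oo], the subgradient inequality at [z] would force [f z = +oo]. *)
Lemma subdifferential_fin_num z x u : f z \is a fin_num ->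
  subdifferential dot f x u -> f x \is a fin_num.
Proof.
move=> fz /(_ z); have [fNy _] := f_proper.
rewrite fin_numE fNy /= -(fineK fz); apply: contraPneq => ->.
by rewrite addye// leye_eq.
Qed.

End Subgradients.

(** * Both regimes assembled *)

(* Each gap f (x k) - min_val f with k >= 2 is finite (x k lies in the domain
   of the subdifferential), so [fine] discards nothing in the O estimates; the
   series and limsups are taken in \bar R. *)
Theorem theorem3p1 (R : realType) (H : completeNormedModType R)
    (dot : {dot H for @idfun R}) (hdot : norm_from_dot dot)
    (f : H -> \bar R) (f_proper : proper_fun f) (f_convex : econvex_fun f)
    (f_lsc : lower_semicontinuous f) (f_argmin : argmin f !=set0)
    (alpha c q p lambda delta : R)
    (alpha_gt0 : 0 < alpha) (c_gt0 : 0 < c) (q_01 : 0 < q < 1)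
    (p_gt1 : 1 < p) (p_le : p <= q + 1)
    (lambda_gt0 : 0 < lambda) (delta_le0 : delta <= 0)
    (lambda_lt1 : delta = 0 -> 0 < lambda < 1)
    (x u xbar : nat -> H)
    (x_rec : forall k : nat, (1 <= k)%N ->
      x k.+1 = prox (step_size lambda delta k) f
        (x k + inertia_coef alpha q k *: (x k - x k.-1)
         - tikhonov_coef c p k *: x k))
    (u_subdiff : forall k : nat, (2 <= k)%N ->
      subdifferential dot f (x k) (u k))
    (u_eq : forall k : nat, (2 <= k)%N ->
      x k = inertia_coef alpha q k.-1 *: (x k.-1 - x k.-2)
            - step_size lambda delta k.-1 *: u k
            + (1 - tikhonov_coef c p k.-1) *: x k.-1)
    (xbar_def : forall k : nat, (1 <= k)%N ->
      xbar k = the_argmin (tikhonov f c p k)) :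
  (p < q + 1 ->
    [/\ bounded_fun x,
        [/\ (fun k : nat => fine (f (x k) - min_val f)%E) =O_\oo
              (fun k : nat => k%:R `^ (- p - delta)),
            (fun k : nat => `|x k - x k.-1|) =O_\oo
              (fun k : nat => k%:R `^ (- (p / 2))) &
            (fun k : nat => `|u k|) =O_\oo
              (fun k : nat => k%:R `^ (- (p / 2) - delta))],
        (forall s : R, 1 / 2 < s < p / 2 ->
          [/\ (\sum_(2 <= k <oo) (k%:R `^ (2 * s + delta - 1))%:E
                 * (f (x k) - min_val f) < +oo)%E,
              (\sum_(1 <= k <oo) (k%:R `^ (2 * s - q)
                 * `|x k - x k.-1| ^+ 2)%:E < +oo)%E &
              (\sum_(2 <= k <oo) (k%:R `^ (2 * s + 2 * delta)
                 * `|u k| ^+ 2)%:E < +oo)%E]) &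
        [/\ (limn_esup (fun n : nat =>
               (\sum_(3 <= k < n.+1) (k%:R `^ (q + delta))%:E
                  * (tikhonov f c p k.-1 (x k.-1)
                     - tikhonov f c p k.-1 (xbar k.-1)))
               * ((n%:R `^ (q + 1 - p))^-1)%:E) < +oo)%E,
            (limn_esup (fun n : nat =>
               ((\sum_(1 <= k < n.+1) k%:R * `|x k - x k.-1| ^+ 2)
                / n%:R `^ (q + 1 - p))%R%:E) < +oo)%E &
            (limn_esup (fun n : nat =>
               ((\sum_(2 <= k < n.+1) k%:R `^ (q + 1 + 2 * delta)
                  * `|u k| ^+ 2)
                / n%:R `^ (q + 1 - p))%R%:E) < +oo)%E]])
  /\
  (p = q + 1 ->
    [/\ [/\ (fun k : nat => fine (f (x k) - min_val f)%E) =O_\oo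
              (fun k : nat => k%:R `^ (- p - delta) * ln k%:R),
            (fun k : nat => `|x k - x k.-1|) =O_\oo
              (fun k : nat => k%:R `^ (- (p / 2)) * Num.sqrt (ln k%:R)) &
            (fun k : nat => `|u k|) =O_\oo
              (fun k : nat =>
                 k%:R `^ (- (p / 2) - delta) * Num.sqrt (ln k%:R))],
        (forall s : R, 1 / 2 < s < p / 2 ->
          [/\ (\sum_(2 <= k <oo) (k%:R `^ (2 * s + delta - 1))%:E
                 * (f (x k) - min_val f) < +oo)%E,
              (\sum_(1 <= k <oo) (k%:R `^ (2 * s - q)
                 * `|x k - x k.-1| ^+ 2)%:E < +oo)%E &
              (\sum_(2 <= k <oo) (k%:R `^ (2 * s + 2 * delta)
                 * `|u k| ^+ 2)%:E < +oo)%E]),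
        [/\ (limn_esup (fun n : nat =>
               (\sum_(3 <= k < n.+1) (k%:R `^ (q + delta))%:E
                  * (tikhonov f c p k.-1 (x k.-1)
                     - tikhonov f c p k.-1 (xbar k.-1)))
               * ((ln n%:R)^-1)%:E) < +oo)%E,
            (limn_esup (fun n : nat =>
               ((\sum_(1 <= k < n.+1) k%:R * `|x k - x k.-1| ^+ 2)
                / ln n%:R)%R%:E) < +oo)%E &
            (limn_esup (fun n : nat =>
               ((\sum_(2 <= k < n.+1) k%:R `^ (q + 1 + 2 * delta)
                  * `|u k| ^+ 2)
                / ln n%:R)%R%:E) < +oo)%E] &
        (delta < 0 ->
          (limn_esup (fun n : nat =>
             (\sum_(3 <= k < n.+1) (k%:R `^ (q + delta))%:E
                * (f (x k.-1) - min_val f))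
             * ((ln n%:R)^-1)%:E) < +oo)%E)]).
Proof.
have [z zmin] := f_argmin; have [q0 q1] := andP q_01.
have mE := min_valE zmin; have fz := argmin_fin_num f_proper zmin.
pose F k := fine (f (x k) - min_val f)%E.
have fx k : (2 <= k)%N -> f (x k) = (fine (f z) + F k)%:E.
  move=> k2; have fk := subdifferential_fin_num f_proper fz (u_subdiff k k2).
  by rewrite /F mE fineB// addrC subrK fineK.
have gapE k : (2 <= k)%N -> (f (x k) - min_val f)%E = (F k)%:E.
  by move=> k2; rewrite fx// mE -(fineK fz) -EFinB/= addrAC subrr add0r.
have F0 k : (2 <= k)%N -> 0 <= F k.
  move=> k2; have := zmin (x k); rewrite /= fx// -{1}(fineK fz) lee_fin.
  by rewrite lerDl.
pose U k := dot (u k) (u k).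
pose A k := dot (x k - x k.-1) (x k - x k.-1).
pose X k := dot (x k) (x k).
(* The inputs are the identity for [u k.+1] in increment form and its subgradient inequality tested
   at [x k] and at [z]. *)
have bound : energy_bound q p delta U A F X.
  apply: (@energy_decay R H dot alpha c q p lambda delta x u z F) => //.
  - move=> k k1; rewrite {1}[x k.+1]u_eq//= -[LHS]addrA; congr (_ + _).
    by rewrite scalerBl scale1r addrAC subrr add0r.
  - move=> k k2; have := u_subdiff k.+1 (leqW k2) (x k).
    rewrite !fx ?(leqW k2)// -EFinD lee_fin -[x k - x k.+1]opprB linearNr.
    lra.
  - move=> k k2; have := u_subdiff k.+1 (leqW k2) z.
    rewrite !fx ?(leqW k2)// -(fineK fz) -EFinD lee_fin -[z - x k.+1]opprB linearNr.
    by rewrite /=; lra.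
have normE y : `|y| ^+ 2 = dot y y by rewrite hdot.
have U0 k : (2 <= k)%N -> 0 <= U k by rewrite /U hdot sqr_ge0.
have A0 k : 0 <= A k by rewrite /A hdot sqr_ge0.
have X0 k : 0 <= X k by rewrite /X hdot sqr_ge0.
have tik j : (2 <= j)%N -> (tikhonov f c p j (x j) - tikhonov f c p j (xbar j)
    <= (F j + c / (2 * j%:R `^ p) * X j)%:E)%E.
  move=> j2; rewrite /tikhonov normE fx// -EFinD.
  have cj y : 0 <= c / (2 * j%:R `^ p) * y ^+ 2.
    by rewrite mulr_ge0 ?sqr_ge0// divr_ge0 ?mulr_ge0 ?powR_ge0// ltW.
  (* The Tikhonov value at [xbar j] is at least [f z]: the penalty is nonnegative and [z] minimizes
     [f]. *)
  apply: (@le_trans _ _ ((fine (f z) + F j + c / (2 * j%:R `^ p) * X j)%:E - f z)%E).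
    apply: leeB => //; apply: le_trans (zmin (xbar j)) _.
    by rewrite leeDl// lee_fin.
  rewrite -(fineK fz) -EFinB lee_fin/=; lra.
have [D D0 hD] := powRS_le (q + delta).
have cc0 : 0 <= c / 2 by rewrite divr_ge0// ltW.
pose gap k : R := F k + c / (2 * k%:R `^ p) * X k.
have gap_ge k : F k <= gap k.
  by rewrite lerDl mulr_ge0// divr_ge0 ?mulr_ge0 ?powR_ge0// ltW.
(* The index shift costs [D]; the penalty has weight of order [k^(q + delta - p)], at most
   [k^(q - p)] because [delta <= 0]. *)
have gap_le k : (2 <= k)%N -> k.+1%:R `^ (q + delta) * gap k
    <= D * (1 + c / 2) * dissipation q p delta U A F X k.
  move=> k2; have k0 : (0 < k)%N := ltnW k2.
  have P0 : 0 < k%:R `^ p :> R by rewrite natr_powR_gt0.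
  have [_ _ _ TF] := dissipation_ge q p delta U0 A0 F0 X0 k2.
  have gap0 : 0 <= gap k := le_trans (F0 _ k2) (gap_ge k).
  apply: le_trans (ler_wpM2r gap0 (hD _ k0)) _.
  rewrite -!mulrA; apply: ler_wpM2l; first exact: ltW.
  rewrite /gap [leLHS]mulrDr [leRHS]mulrDl [1 * _]mul1r; apply: lerD => //.
  rewrite [leLHS](_ : _ = c / 2 * (k%:R `^ (q + delta) / k%:R `^ p * X k));
    last by field; rewrite gt_eqF.
  apply: ler_wpM2l => //.
  apply: (@le_trans _ _ (k%:R `^ (q - p) * X k)).
    apply: ler_wpM2r => //; rewrite -powRN -natr_powRD//.
    by apply: natr_ler_powR => //; lra.
  have [h1 h2 h3] : [/\ 0 <= k%:R `^ (q + 1 + 2 * delta) * U k, 0 <= k%:R * A k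
      & 0 <= k%:R `^ (q + delta) * F k].
    by rewrite !mulr_ge0 ?powR_ge0 ?ler0n ?U0 ?F0.
  by rewrite /dissipation lerDr !addr_ge0.
(* Adding [2 * s - q - 1] to the dissipation exponents [q + delta], [1], [q + 1 + 2 * delta] gives
   the three exponents, in both regimes. *)
have series s : 1 / 2 < s < p / 2 ->
    [/\ (\sum_(2 <= k <oo) (k%:R `^ (2 * s + delta - 1))%:E
           * (f (x k) - min_val f) < +oo)%E,
        (\sum_(1 <= k <oo) (k%:R `^ (2 * s - q)
           * `|x k - x k.-1| ^+ 2)%:E < +oo)%E &
        (\sum_(2 <= k <oo) (k%:R `^ (2 * s + 2 * delta)
           * `|u k| ^+ 2)%:E < +oo)%E].
  move=> /andP[_ sp]; have sp2 : 2 * s < p by lra.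
  have le_series := energy_series bound U0 A0 F0 X0 sp2 p_le.
  have Tk k : (3 <= k)%N ->
    [/\ k%:R `^ (2 * s + delta - 1) * F k
         <= 1 * (k%:R `^ (2 * s - q - 1) * dissipation q p delta U A F X k),
       k%:R `^ (2 * s - q) * A k
         <= 1 * (k%:R `^ (2 * s - q - 1) * dissipation q p delta U A F X k) &
       k%:R `^ (2 * s + 2 * delta) * U k
         <= 1 * (k%:R `^ (2 * s - q - 1) * dissipation q p delta U A F X k)].
    move=> k3; have k2 := ltnW k3; have k0 := ltnW k2.
    have [t0 t1 t2 t3] := dissipation_ge q p delta U0 A0 F0 X0 k2.
    have w0 : 0 <= k%:R `^ (2 * s - q - 1) :> R by exact: powR_ge0.
    rewrite mul1r; split.
    - rewrite (_ : 2 * s + delta - 1 = 2 * s - q - 1 + (q + delta)); last by ring.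
      by rewrite natr_powRD// -mulrA; apply: ler_wpM2l.
    - rewrite [X in _ `^ X * A k](_ : _ = 2 * s - q - 1 + 1); last by ring.
      by rewrite natr_powRD// powRr1 ?ler0n// -mulrA; apply: ler_wpM2l.
    - rewrite (_ : 2 * s + 2 * delta = 2 * s - q - 1 + (q + 1 + 2 * delta)); last by ring.
      by rewrite natr_powRD// -mulrA; apply: ler_wpM2l.
  split.
  - rewrite (_ : limn _ = (\sum_(2 <= k <oo)
      (k%:R `^ (2 * s + delta - 1) * F k)%:E)%E).
      apply: (le_series _ 1) => // k k2 /=; first by rewrite mulr_ge0 ?powR_ge0 ?F0.
      by have [] := Tk k k2.
    congr (limn _); apply/funext => n; apply: eq_big_nat => k /andP[k2 _].
    by rewrite gapE// EFinM.
  - apply: (le_series _ 1) => // k k2 /=; rewrite normE.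
    by have [] := Tk k k2.
  - apply: (le_series _ 1) => // k k2 /=; rewrite normE.
    by have [] := Tk k k2.
(* Kept generic in [r] for both regimes, and in [a] so that it covers the Tikhonov gaps and the gaps
   of [f] alike. *)
have limsups (r : nat -> R) (C' : R) : 0 < C' ->
    (forall k, (2 <= k)%N -> k%:R `^ (q - p) <= C' * (r k.+1 - r k)) ->
    (forall k, (2 <= k)%N -> 0 < r k) ->
    [/\ forall (s : nat -> R) (a : nat -> \bar R),
          (forall k, (2 <= k)%N -> 0 <= s k <= gap k) ->
          (forall k, (2 <= k)%N -> (a k <= (s k)%:E)%E) ->
          (limn_esup (fun n : nat =>
             (\sum_(3 <= k < n.+1) (k%:R `^ (q + delta))%:E * a k.-1)
             * ((r n)^-1)%:E) < +oo)%E,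
        (limn_esup (fun n : nat =>
           ((\sum_(1 <= k < n.+1) k%:R * `|x k - x k.-1| ^+ 2)
            / r n)%R%:E) < +oo)%E &
        (limn_esup (fun n : nat =>
           ((\sum_(2 <= k < n.+1) k%:R `^ (q + 1 + 2 * delta)
              * `|u k| ^+ 2) / r n)%R%:E) < +oo)%E].
  move=> C'0 hr r0; split.
  - move=> s a sgap as_.
    have s0 k : (2 <= k)%N -> 0 <= s k by move=> /sgap/andP[].
    have DM0 : 0 <= D * (1 + c / 2) by rewrite mulr_ge0 ?(ltW D0)// addr_ge0.
    have ws0 k : (2 <= k)%N -> 0 <= k.+1%:R `^ (q + delta) * s k.
      by move=> k2; rewrite mulr_ge0 ?powR_ge0 ?s0.
    have wsT k : (3 <= k)%N -> k.+1%:R `^ (q + delta) * s k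
        <= D * (1 + c / 2) * dissipation q p delta U A F X k.
      move=> /ltnW k2; apply: le_trans (gap_le _ k2).
      by apply: ler_wpM2l; [exact: powR_ge0|have /andP[] := sgap _ k2].
    have [C [k1 [k13 hC]]] := energy_sum_rate bound U0 A0 F0 X0 C'0 hr r0
      (isT : (2 <= 3)%N) DM0 ws0 wsT.
    apply: (@limn_esup_weighted _ (fun k => k%:R `^ (q + delta)) s r a C k1) => //.
    by move=> n kn; apply/r0/ltnW/(leq_trans k13).
  - apply: (energy_limsup bound U0 A0 F0 X0 C'0 hr r0 _ ler01) => // k k3.
    rewrite normE mul1r.
    by have [] := dissipation_ge q p delta U0 A0 F0 X0 (ltnW k3).
  - apply: (energy_limsup bound U0 A0 F0 X0 C'0 hr r0 _ ler01) => // k k3.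
    rewrite normE mul1r.
    by have [] := dissipation_ge q p delta U0 A0 F0 X0 (ltnW k3).
have gap_ok k : (2 <= k)%N -> 0 <= gap k <= gap k.
  by move=> k2; rewrite lexx andbT (le_trans (F0 _ k2)).
have F_ok k : (2 <= k)%N -> 0 <= F k <= gap k.
  by move=> k2; rewrite F0//=.
split.
(* With [b = q + 1 - p] the forcing is [k^(b - 1)], and [b <= 1] since [q < 1 < p]. *)
- move=> pq; have b0 : 0 < q + 1 - p by lra.
  have b1 : q + 1 - p <= 1 by lra.
  have [C' C'0] := rate_powR b0 b1.
  have -> : q + 1 - p - 1 = q - p by ring.
  move=> hr; pose r k : R := k%:R `^ (q + 1 - p).
  have r0 k : (2 <= k)%N -> 0 < r k by move=> /ltnW; exact: natr_powR_gt0.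
  have [K [k1 [K0 k13 hK]]] := energy_pointwise bound U0 A0 F0 X0 C'0 hr r0.
  have kp k : (k1 <= k)%N -> (0 < k)%N by apply: leq_trans; apply: leq_trans k13.
  have [L1 L2 L3] := limsups _ _ C'0 hr r0.
  split.
  + have XK k : (k1 <= k)%N -> X k <= K.
      move=> kk; have [_ _ _] := hK _ kk; rewrite -natr_powRD ?kp//.
      by rewrite (_ : _ + _ = 0) ?powRr0 ?mulr1//; ring.
    apply: (@bounded_eventually _ _ _ (K + 1) k1) => k kk.
    rewrite -ler_sqr ?nnegrE ?addr_ge0 ?(ltW K0)// normE.
    by apply: le_trans (XK _ kk) _; have := sqr_ge0 K; lra.
  + split.
    * apply: (@eqO_eventually _ _ _ K k1) => k kk.
      have [+ _ _ _] := hK _ kk; rewrite -natr_powRD ?kp//.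
      rewrite ger0_norm ?F0//; last exact: leq_trans (ltnW k13) kk.
      by congr (_ <= _ * _ `^ _); ring.
    * apply: (@eqO_sqr _ _ _ K k1) => // [|k kk]; first exact: ltW.
      have [_ + _ _] := hK _ kk; rewrite normE -powR_mulrn ?powR_ge0// -powRrM.
      by rewrite -natr_powRD ?kp//; congr (_ <= _ * _ `^ _); field.
    * apply: (@eqO_sqr _ _ _ K k1) => // [|k kk]; first exact: ltW.
      have [_ _ + _] := hK _ kk; rewrite normE -powR_mulrn ?powR_ge0// -powRrM.
      by rewrite -natr_powRD ?kp//; congr (_ <= _ * _ `^ _); field.
  + exact: series.
  + split.
    * exact: L1 gap_ok tik.
    * exact: L2.
    * exact: L3.
(* The forcing is now [1 / k], with primitive [ln k], positive from index 2 on. *)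
- move=> pq; have [C' C'0 hr] := rate_ln R.
  have e1 : -1 = q - p by rewrite pq; ring.
  rewrite e1 in hr.
  have r0 k : (2 <= k)%N -> 0 < ln k%:R :> R by move=> k2; rewrite ln_gt0// ltr1n.
  have [K [k1 [K0 k13 hK]]] := energy_pointwise bound U0 A0 F0 X0 C'0 hr r0.
  have [L1 L2 L3] := limsups _ _ C'0 hr r0.
  split; [split| |split|] => //.
  + apply: (@eqO_eventually _ _ _ K k1) => k kk.
    have [+ _ _ _] := hK _ kk; rewrite mulrC.
    rewrite ger0_norm ?F0//; last exact: leq_trans (ltnW k13) kk.
    rewrite mulrC [ln _ * _]mulrC.
    by congr (_ <= _ * (_ `^ _ * _)); rewrite pq; ring.
  + apply: (@eqO_sqr _ _ _ K k1) => // [|k kk]; first exact: ltW.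
    have [_ + _ _] := hK _ kk; rewrite normE exprMn -powR_mulrn ?powR_ge0// -powRrM.
    rewrite sqr_sqrtr ?ln_ge0 ?ler1n ?(leq_trans (ltnW (ltnW k13)) kk)// [_ * ln _]mulrC.
    by congr (_ <= _ * (_ * _ `^ _)); rewrite pq; field.
  + apply: (@eqO_sqr _ _ _ K k1) => // [|k kk]; first exact: ltW.
    have [_ _ + _] := hK _ kk; rewrite normE exprMn -powR_mulrn ?powR_ge0// -powRrM.
    rewrite sqr_sqrtr ?ln_ge0 ?ler1n ?(leq_trans (ltnW (ltnW k13)) kk)// [_ * ln _]mulrC.
    by congr (_ <= _ * (_ * _ `^ _)); rewrite pq; field.
  + exact: L1 gap_ok tik.
  (* The gap of [f] itself lies between 0 and [gap], so the weighted limsup applies with [s = F]. *)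
  + move=> _; apply: (L1 _ (fun k => f (x k) - min_val f)%E F_ok) => k k2.
    by rewrite gapE.
Qed.
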